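(* Let $V=\mathrm{Sym}(3,\mathbb{C})$ be the space of complex symmetric $3\times 3$ matrices, with $G=\mathrm{SL}(3,\mathbb{C})$ acting by $g\cdot x=gxg^t$. Let $p\geq 1$, let $A(p)=\mathbb{C}[pV]^G$, and let $B(p)$ be the subalgebra of $A(p)$ generated by the polynomials $(x_1,\dots,x_p)\mapsto f(x_i,x_j,x_k)$, $1\leq i,j,k\leq p$. Then the algebra $A(p)$ is integral over $B(p)$.
   Context: $pV=V\oplus\cdots\oplus V$ ($p$ summands) with the diagonal action of $G$, and $\mathbb{C}[pV]^G$ is the algebra of $G$-invariant polynomial functions on $pV$. $f$ denotes the symmetric trilinear form on $V$ obtained by full polarization of $\det$, normalized by $f(x,x,x)=6\det x$; equivalently $f(x,y,z)$ is the coefficient of $abc$ in $\det(ax+by+cz)$. *)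

(* Defs.v *)
From HB Require Import structures.
From mathcomp Require Import all_boot all_order all_algebra.
From mathcomp Require Import complex.
From mathcomp Require Import mpoly.
From mathcomp Require Import boolp classical_sets functions reals.

Set Implicit Arguments.
Unset Strict Implicit.
Unset Printing Implicit Defensive.
Import GRing.Theory.
Local Open Scope classical_set_scope.
Local Open Scope ring_scope.

(* Missing from functions.v: pointwise operations make T -> A an algebra. *)
Section FunctionAlgebra.
Variables (T : pointedType) (K : nzRingType) (A : lalgType K).

Let fct_scalerAl (c : K) (F G : T -> A) : c *: (F * G) = (c *: F) * G.
Proof. by apply/funext => x; exact: scalerAl. Qed.

HB.instance Definition _ :=
  GRing.Lmodule_isLalgebra.Build K (T -> A) fct_scalerAl.
End FunctionAlgebra.

Definition generated_subalgebra (K : nzRingType) (A : lalgType K) (G : set A) :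
    set A :=
  smallest (fun S : set A => GRing.subalg_closed (mem S)) G.

Definition integral_over (A : nzRingType) (B : set A) (a : A) : Prop :=
  exists q : {poly A}, [/\ q \is monic, forall n, B q`_n & root q a].

Section SymmetricMatrices.
Variable R : realType.
Local Notation C := R[i].

Definition symmat := {x : 'M[C]_3 | x^T == x}.

Lemma symmat0_subproof : (0 : 'M[C]_3)^T == 0.
Proof. by rewrite trmx0. Qed.

HB.instance Definition _ := Choice.on symmat.
HB.instance Definition _ :=
  isPointed.Build symmat (exist _ (0 : 'M[C]_3) symmat0_subproof).

Lemma act_subproof (g : 'M[C]_3) (x : symmat) :
  (g *m val x *m g^T)^T == g *m val x *m g^T.
Proof. by rewrite !trmx_mul trmxK (eqP (valP x)) mulmxA. Qed.

Definition act (g : 'M[C]_3) (x : symmat) : symmat :=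
  exist _ (g *m val x *m g^T) (act_subproof g x).

(* f(x,y,z) is the coefficient of abc in det(ax + by + cz), where a, b, c are
   the three variables of {mpoly C[3]}. *)
Definition polar_det (x y z : symmat) : C :=
  (\det ('X_(0 : 'I_3) *: map_mx (@mpolyC 3 C) (val x)
         + 'X_(1 : 'I_3) *: map_mx (@mpolyC 3 C) (val y)
         + 'X_(2 : 'I_3) *: map_mx (@mpolyC 3 C) (val z)))
  @_[multinom 1%N | _ < 3].

Section Copies.
Variable p : nat.

Definition copies := 'I_p -> symmat.
HB.instance Definition _ := Pointed.on copies.

Definition coordinates (x : copies) (k : 'I_#|{: 'I_p * 'I_3 * 'I_3}|) : C :=
  let: (i, a, b) := enum_val k in val (x i) a b.

(* The 9p matrix entries span the linear forms on pV, with redundancy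
   (x i a b = x i b a): the functions below are exactly the restrictions to pV
   of polynomials in the entries, i.e. the polynomial functions on pV. *)
Definition polynomial_function (F : copies -> C) : Prop :=
  exists P : {mpoly C[#|{: 'I_p * 'I_3 * 'I_3}|]},
    forall x, F x = P.@[coordinates x].

Definition invariant (F : copies -> C) : Prop :=
  forall g : 'M[C]_3, \det g = 1 -> forall x, F (fun i => act g (x i)) = F x.

Definition invariant_algebra : set (copies -> C) :=
  [set F | polynomial_function F /\ invariant F].

Definition polar_det_algebra : set (copies -> C) :=
  generated_subalgebra
    [set F | exists i j k, F = fun x => polar_det (x i) (x j) (x k)].

End Copies.
End SymmetricMatrices.

Arguments invariant_algebra R p : clear implicits.
Arguments polar_det_algebra R p : clear implicits.

(* Main.v *)
Require Import Defs.
From HB Require Import structures.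
From mathcomp Require Import all_boot all_order all_algebra.
From mathcomp Require Import complex ring.
From mathcomp Require Import mpoly.
From mathcomp Require Import boolp classical_sets functions reals.
Set Implicit Arguments.
Unset Strict Implicit.
Unset Printing Implicit Defensive.
Import GRing.Theory.
Local Open Scope classical_set_scope.
Local Open Scope ring_scope.

(** The proof tests integrality on valuation rings.

An element F of a commutative ring A is integral over a subring B as soon as, for
every homomorphism pi from A onto a field K and every valuation ring O of K with
pi(B) contained in O, pi(F) lies in O ([valuative_criterion]; A is von Neumann
regular there, which makes the quotients by primes fields). Here A is the ring of
all functions from pV to C. As quotients of A, the fields K inherit two things
from C by pointwise constructions: square roots, and the fact that an element of
SL(3,K) comes from a function pV -> SL(3,C) ([lift_special_linear]).

Given pi and O, let Z_i be the symmetric matrix over K obtained by applying pi to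
the entries of the i-th generic matrix. The values f(Z_i,Z_j,Z_k) lie in O, so
det takes values in O on the O-module L spanned by the Z_i. The core of the proof
is [adapted_basis]: there is g in SL(3,K) such that every g Z_i g^t has its
entries in O. This is the valuative form of the fact that a linear space of
singular symmetric 3x3 matrices is destabilized by a one-parameter subgroup. Lift
g to a function pV -> SL(3,C). By invariance F(x) = F(g(x).x), and the right-hand
side is a polynomial with complex coefficients in functions that pi maps into O;
hence pi(F) is in O.

For [adapted_basis], a symmetric matrix is viewed as a bilinear form and g as a
basis of K^3 of volume 1. After two rescalings by square roots of elements
of minimal valuation, all the forms are integral and some form y in L has a unit 2x2
minor, hence becomes 2 X1 X2 + e X3^2 in a basis (u,v,w) whose volume D is now
arbitrary ([normalized_adapted], [isotropic_adapted]). Expanding the determinants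
of z, y + z, y - z, all in D^2 O, shows that z(w,w), z(u,w) z(v,w) and
z(u,u) z(v,w)^2 + z(v,v) z(u,w)^2 are in D^2 O ([hyperbolic_relations]). With a a
value z(u,w) of minimal valuation, at most that of all z(v,w) up to exchanging u
and v, the basis (t u, v/t, w/D) works for t = 1 or t = D/a
([hyperbolic_adapted_wlog]). *)

(** * Subrings, field quotients and integral elements *)

(** Bundling a subring given by a proposition gives access to the closure lemmas
of the algebraic hierarchy, for the subring and for polynomials over it. *)
Lemma subringClosed_of (A : comNzRingType) (P : A -> Prop) :
  P 1 -> (forall x y, P x -> P y -> P (x - y)) ->
  (forall x y, P x -> P y -> P (x * y)) ->
  exists S : subringClosed A, forall x, x \in S <-> P x.
Proof.
move=> P1 PB PM; pose T := [pred x | `[< P x >]].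
have TP x : x \in T <-> P x.
  by rewrite inE; split=> [/asboolP|Px] //; apply/asboolP.
have Tc : subring_closed T.
  by split=> [|x y /TP Px /TP Py|x y /TP Px /TP Py]; apply/TP; auto.
have m := GRing.isSubringClosed.Build A T Tc.
pose S : subringClosed A := HB.pack_for (subringClosed A) (T : {pred A}) m.
exists S => x; exact: TP.
Qed.

Lemma field_quotient (A : comNzRingType) (I : A -> Prop) :
  ~ I 1 -> I 0 -> (forall x y, I x -> I y -> I (x - y)) ->
  (forall x y, I x -> I (x * y)) ->
  (forall x, I x \/ exists y, I (1 - x * y)) ->
  exists (K : fieldType) (pi : {rmorphism A -> K}),
    (forall y, exists x, pi x = y) /\ (forall x, pi x = 0 <-> I x).
Proof.
move=> I1 I0 IB IM Imax.
pose T := [pred x | `[< I x >]].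
have TP x : x \in T <-> I x.
  by rewrite inE; split=> [/asboolP|Px] //; apply/asboolP.
have Tc : idealr_closed (T : {pred A}).
  split; [exact/TP | by apply/negP => /TP | move=> a u v /TP Iu /TP Iv; apply/TP].
  have IN x : I x -> I (- x) by move=> Ix; rewrite -sub0r; apply: IB.
  by rewrite -[v]opprK; apply: IB; [rewrite mulrC; apply: IM | apply: IN].
pose J : idealr A :=
  HB.pack_for (idealr A) (T : {pred A}) (isIdealr.Build A T Tc).
pose Q : comNzRingType := {ideal_quot J}.
pose f : {rmorphism A -> Q} := \pi_({ideal_quot J})%qT.
have fsurj y : exists x, f x = y by exists (repr y); exact: reprK.
have f0 x : f x = 0 <-> I x.
  have E : (x \in J) = (f x == f 0).
    by rewrite -[x in LHS]subr0; exact: Quotient.idealrBE.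
  rewrite -(rmorph0 f) -TP; split=> [/eqP fx|xT]; first by move: fx; rewrite -E.
  by apply/eqP; rewrite -E.
have inv_ex (y : Q) : exists z, y != 0 -> z * y = 1.
  have [x <-] := fsurj y; case: (Imax x) => [/f0->|[z /f0 fz]].
    by exists 0; rewrite eqxx.
  exists (f z) => _; apply/esym/eqP; rewrite -subr_eq0 mulrC.
  by rewrite -(rmorph1 f) -rmorphM -rmorphB; apply/eqP.
have [inv invP] := choice inv_ex.
pose inv' y := if y == 0 then 0 else inv y.
have mulVf y : y != 0 -> inv' y * y = 1.
  by move=> y0; rewrite /inv' (negPf y0); exact: invP.
have inv0 : inv' 0 = 0 by rewrite /inv' eqxx.
pose K : fieldType := HB.pack_for fieldType (GRing.ComNzRing.sort Q)
  (GRing.ComNzRing_isField.Build Q mulVf inv0).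
by exists K, f.
Qed.

(** Written a^n = p(a) with deg p < n, an integral equation is easy to multiply by a
and to lift along a quotient, where leading coefficients need no care. *)
Lemma integral_overP (A : comNzRingType) (S : subringClosed A) (a : A) :
  integral_over [set` S] a <->
  exists n (p : {poly A}), [/\ p \is a polyOver S, (size p <= n)%N & a ^+ n = p.[a]].
Proof.
split=> [[q [q_monic Sq /rootP qa0]]|[n [p [Sp le_pn an]]]].
  have q_gt0 : (0 < size q)%N by rewrite size_poly_gt0 monic_neq0.
  have Sp : q \is a polyOver S by apply/polyOverP.
  exists (size q).-1, ('X^((size q).-1) - q); split.
  - by rewrite rpredB ?rpredX ?polyOverX.
  - apply/leq_sizeP => j le_j; rewrite coefB coefXn.
    move: le_j; rewrite leq_eqVlt => /orP[/eqP <-|lt_j].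
      by rewrite eqxx -/(lead_coef q) (monicP q_monic) subrr.
    rewrite gtn_eqF // nth_default ?subrr //.
    by rewrite -(prednK q_gt0).
  - by rewrite hornerD hornerN hornerXn qa0 subr0.
exists ('X^n - p); split.
- by rewrite monicE lead_coefDl ?lead_coefXn // size_polyN size_polyXn.
- by move=> i; apply: (polyOverP _); rewrite rpredB ?rpredX ?polyOverX.
- by rewrite /root hornerD hornerN hornerXn an subrr.
Qed.

Lemma integral_overW (A : comNzRingType) (S T : set A) (a : A) :
  S `<=` T -> integral_over S a -> integral_over T a.
Proof. by move=> ST [q [qm Sq qa]]; exists q; split=> // n; apply: ST. Qed.

Lemma adjoin_ideal (A : comNzRingType) (S : subringClosed A) (e : A) :
  exists T : subringClosed A,
    forall x, x \in T <-> exists2 s, s \in S & exists v, x = s + e * v.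
Proof.
apply: subringClosed_of.
- by exists 1; rewrite ?rpred1 //; exists 0; ring.
- move=> _ _ [s Ss [v ->]] [t St [w ->]].
  by exists (s - t); rewrite ?rpredB //; exists (v - w); ring.
- move=> _ _ [s Ss [v ->]] [t St [w ->]].
  by exists (s * t); rewrite ?rpredM //; exists (s * w + t * v + v * e * w); ring.
Qed.

Lemma adjoin_element (A : comNzRingType) (S : subringClosed A) (u : A) :
  exists T : subringClosed A,
    forall x, x \in T <-> exists2 p, p \is a polyOver S & x = p.[u].
Proof.
apply: subringClosed_of.
- by exists 1; rewrite ?rpred1 ?hornerC.
- move=> _ _ [p Sp ->] [q Sq ->].
  by exists (p - q); rewrite ?rpredB // hornerD hornerN.
- move=> _ _ [p Sp ->] [q Sq ->].
  by exists (p * q); rewrite ?rpredM // hornerM.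
Qed.

(** An integral equation involves finitely many coefficients, so non-integrality
passes to unions of chains and Zorn's lemma applies. *)
Lemma maximal_nonintegral_subring (A : comNzRingType) (B : subringClosed A)
    (a : A) : ~ integral_over [set` B] a ->
  exists S : subringClosed A, [/\ {subset B <= S}, ~ integral_over [set` S] a &
    forall T : subringClosed A, {subset S <= T} ->
      {subset T <= S} \/ integral_over [set` T] a].
Proof.
move=> Ba; (* Adding B to X makes the property hold for the union of the empty chain. *)
pose P (X : set A) := exists S : subringClosed A,
  [set` S] = [set` B] `|` X /\ ~ integral_over [set` S] a.
have [F FP Ftot|X [[S [SE Sa]] Xmax]] := @Zorn_bigcup A P.
  have [[X0 FX0]|F0] := pselect (exists X, F X); last first.
    exists B; split=> //; apply/esym/setUidPl => x [X FX _].
    by case: F0; exists X.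
  pose U : set A := [set` B] `|` \bigcup_(X in F) X.
  have common (s : seq A) : (forall x, x \in s -> U x) ->
      exists2 X, F X & forall x, x \in s -> ([set` B] `|` X) x.
    elim: s => [|x s IHs] Us; first by exists X0.
    have [y ys|X FX sX] := IHs; first by apply: Us; rewrite inE ys orbT.
    have [Bx|[Y FY Yx]] := Us x (mem_head _ _).
      exists X => // y; rewrite inE => /orP[/eqP->|/sX//]; by left.
    case: (Ftot X Y FX FY) => [XY|YX].
      exists Y => // y; rewrite inE => /orP[/eqP->|/sX [|/XY]]; by [right|left].
    exists X => // y; rewrite inE => /orP[/eqP->|/sX//]; by right; apply: YX.
  have two x y : U x -> U y -> exists S : subringClosed A,
      [/\ x \in S, y \in S & [set` S] `<=` U].
    move=> Ux Uy; have [z|X FX X2] := common [:: x; y].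
      by rewrite !inE => /orP[] /eqP->.
    have [S [SE _]] := FP X FX; exists S; split.
    - by have := X2 x (mem_head _ _); rewrite -SE.
    - by have := X2 y; rewrite !inE eqxx orbT -SE; apply.
    - by rewrite SE => z [Bz|Xz]; [left|right; exists X].
  have [|x y Ux Uy|x y Ux Uy|S SU] := @subringClosed_of A U.
  - by left; rewrite /= rpred1.
  - have [S [Sx Sy SU]] := two x y Ux Uy.
    by apply: SU; rewrite /= rpredB.
  - have [S [Sx Sy SU]] := two x y Ux Uy.
    by apply: SU; rewrite /= rpredM.
  exists S; split; first by apply/seteqP; split=> x /SU.
  move=> [q [q_monic Sq qa]].
  have [x xq|X FX Xq] := common q.
    apply/SU; have [i _ <-] := nthP 0 xq; exact: Sq.
  have [T [TE]] := FP X FX; apply; exists q; split=> // i.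
  rewrite TE; have [lt_i|le_i] := ltnP i (size q); first exact/Xq/mem_nth.
  by left; rewrite nth_default //= rpred0.
exists S; split=> // [x Bx|T ST].
  by have : [set` S] x by rewrite SE; left.
have [Ta|Ta] := pselect (integral_over [set` T] a); [by right|left].
have XT : X `<=` [set` T].
  by move=> x Xx; apply: ST; have : [set` S] x by rewrite SE; right.
have [TX|nTX] := pselect ([set` T] `<=` X).
  by move=> x /TX Xx; have : [set` S] x by rewrite SE; right.
exfalso; apply: (Xmax [set` T]) => //; exists T; split=> //.
apply/esym/setUidPr => x Bx; apply: ST.
by have : [set` S] x by rewrite SE; left.
Qed.

(** The idempotent e = u w splits A into e A and (1 - e) A. If S + uA and
S + (1 - e)A were both larger than S, each would give a monic polynomial over S
whose value at a lies in uA, respectively in (1 - e)A; the product of the two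
would vanish at a. So S contains one of these ideals: the largest ideal of A
contained in S is maximal. *)
Lemma maximal_ideal_of_maximal_subring (A : comNzRingType)
    (S : subringClosed A) (a u w : A) :
  ~ integral_over [set` S] a ->
  (forall T : subringClosed A, {subset S <= T} ->
      {subset T <= S} \/ integral_over [set` T] a) ->
  u * (1 - u * w) = 0 ->
  (forall v, u * v \in S) \/ (forall v, (1 - u * w) * v \in S).
Proof.
move=> Sa Smax uw0.
have approx e : (forall v, e * v \in S) \/ exists (q : {poly A}) t,
    [/\ q \is monic, q \is a polyOver S & q.[a] = e * t].
  have [T TP] := adjoin_ideal S e.
  have ST : {subset S <= T}.
    by move=> s Ss; apply/TP; exists s => //; exists 0; ring.
  have [TS|/integral_overP[n [p [Tp le_pn an]]]] := Smax T ST.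
    left=> v; apply: TS; apply/TP; exists 0; rewrite ?rpred0 //.
    by exists v; ring.
  right; have /choice[f fP] i : exists sv : A * A,
      sv.1 \in S /\ p`_i = sv.1 + e * sv.2.
    have /TP[s Ss [v ->]] := polyOverP Tp i; by exists (s, v).
  pose r := \poly_(i < n) (f i).1; pose t := \poly_(i < n) (f i).2.
  have pE : p = r + e *: t.
    apply/polyP => i; rewrite coefD coefZ !coef_poly.
    case: ltnP => [_|le_ni]; first exact: (fP i).2.
    by rewrite nth_default ?mulr0 ?addr0 // (leq_trans le_pn).
  have Sr : r \is a polyOver S.
    by apply/polyOver_poly => i _; exact: (fP i).1.
  exists ('X^n - r), t.[a]; split.
  - rewrite monicE lead_coefDl ?lead_coefXn // size_polyN size_polyXn.
    by rewrite ltnS size_poly.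
  - by rewrite rpredB ?rpredX ?polyOverX.
  - by rewrite hornerD hornerN hornerXn an pE hornerD hornerZ; ring.
have [|[q [t [qm Sq qa]]]] := approx u; first by left.
have [|[q' [t' [qm' Sq' qa']]]] := approx (1 - u * w); first by right.
case: Sa; exists (q * q'); split.
- by rewrite monicMl.
- by move=> i; apply: (polyOverP _); rewrite rpredM.
- by rewrite /root hornerM qa qa' mulrACA uw0 mul0r.
Qed.

(** If both degrees are positive, the equation of smaller degree lowers the degree
of the other one; this ends with an equation of degree 0, which puts 1 in I. *)
Lemma chevalley_descent (K : fieldType) (R : subringClosed K) (I : K -> Prop)
    (u : K) (h k : {poly K}) :
  (forall x y, I x -> I y -> I (x + y)) ->
  (forall x y, x \in R -> I y -> I (x * y)) -> (forall x, I x -> x \in R) ->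
  u != 0 -> (forall i, I h`_i) -> (forall i, I k`_i) ->
  h.[u] = 1 -> k.[u^-1] = 1 -> I 1.
Proof.
move=> ID IM IR u0; have [N] := ubnP (size h + size k).
elim: N => // N IHN in u u0 h k *.
wlog le_kh : u u0 h k / (size k <= size h)%N => [wl|le_N Ih Ik hu ku].
  have [/wl|/ltnW le_hk le_N Ih Ik hu ku] := leqP (size k) (size h); first exact.
  by apply: (wl u^-1 _ k h) => //; rewrite ?invr_eq0 ?invrK // addnC.
have I0 : I 0 by rewrite -(mul0r h`_0); apply: IM; rewrite ?rpred0.
have [le_k1|lt1k] := leqP (size k) 1.
  by rewrite -ku (size1_polyC le_k1) hornerC; apply: Ik.
have h_gt0 : (0 < size h)%N by rewrite (leq_trans _ le_kh) // ltnW.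
pose n := (size h).-1; have nE : n.+1 = size h by rewrite prednK.
(* The equation k.[1/u] = 1 makes (1 - k_0) u^n a combination of lower powers of
   u with coefficients in I. With this substitution in its top term,
   (1 - k_0) h + k_0 becomes h', whose value at u is again 1. *)
pose h' := \poly_(i < n) ((k`_0 *+ (i == 0%N)) + (1 - k`_0) * h`_i
                          + h`_n * k`_(n - i)).
have Rk0 : 1 - k`_0 \in R by rewrite rpredB ?rpred1 ?IR.
have n_gt0 : (0 < n)%N by rewrite -ltnS nE (leq_trans lt1k).
apply: (IHN u u0 h' k) => //.
- rewrite -ltnS (leq_trans _ le_N) // ltnS.
  by rewrite -nE addSn ltnS leq_add2r size_poly.
- move=> i; rewrite coef_poly; case: ifP => // _.
  apply: (ID); first apply: (ID).
  + by case: (i == 0%N); rewrite ?mulr1n ?mulr0n.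
  + exact: IM.
  + by apply: IM => //; apply: IR.
have kun : \sum_(i < n) k`_(n - i) * u ^+ i = (1 - k`_0) * u ^+ n.
  have : \sum_(i < n.+1) k`_(n - i) * u ^+ i = u ^+ n.
    have le_kn : (size k <= n.+1)%N by rewrite nE.
    rewrite -[RHS]mulr1 -ku (horner_coef_wide _ le_kn) mulr_sumr.
    rewrite (reindex_inj rev_ord_inj) /=; apply: eq_bigr => i _.
    rewrite subSS subKn -1?ltnS // mulrCA exprVn; congr (_ * _).
    by rewrite expfB_cond // (negPf u0) add0n -ltnS.
  rewrite big_ord_recr /= subnn => /(canRL (addrK _)) ->; ring.
have hun : \sum_(i < n) h`_i * u ^+ i = 1 - h`_n * u ^+ n.
  by rewrite -hu horner_coef -nE big_ord_recr /= addrK.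
rewrite (horner_coef_wide _ (size_poly _ _)).
under eq_bigr => i _ do rewrite coef_poly ltn_ord !mulrDl -!mulrA.
rewrite !big_split /= -!mulr_sumr kun hun.
rewrite -(prednK n_gt0) big_ord_recl /= big1 ?addr0; last first.
  by move=> i _; rewrite mulr0n mul0r.
rewrite prednK //; ring.
Qed.

(** An element a <> 0 is integral over S exactly when 1 lies in the ideal generated
by 1/a in S[1/a]; the descent is applied to that ideal. *)
Lemma integral_over_adjoin (K : fieldType) (S T U : subringClosed K) (a u : K) :
  u != 0 ->
  (forall x, x \in T -> exists2 p, p \is a polyOver S & x = p.[u]) ->
  (forall x, x \in U -> exists2 p, p \is a polyOver S & x = p.[u^-1]) ->
  integral_over [set` T] a -> integral_over [set` U] a ->
  integral_over [set` S] a.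
Proof.
move=> u0 TP UP Ta Ua; have [a0|a0] := eqVneq a 0.
  apply/integral_overP; exists 1%N, 0; split; rewrite ?rpred0 ?size_poly0 //.
  by rewrite a0 horner0 expr1.
have [R RP] := adjoin_element S a^-1.
pose I x := exists2 y, y \in R & x = a^-1 * y.
have Ra : a^-1 \in R.
  by apply/RP; exists 'X; rewrite ?polyOverX ?hornerX.
have SR : {subset S <= R}.
  by move=> s Ss; apply/RP; exists s%:P; rewrite ?polyOverC ?hornerC.
have ID x y : I x -> I y -> I (x + y).
  move=> [x' Rx ->] [y' Ry ->]; exists (x' + y'); rewrite ?rpredD //; ring.
have IM x y : x \in R -> I y -> I (x * y).
  move=> Rx [y' Ry ->]; exists (x * y'); rewrite ?rpredM //; ring.
have IR x : I x -> x \in R by move=> [y Ry ->]; rewrite rpredM.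
have step (V : subringClosed K) v :
    (forall x, x \in V -> exists2 p, p \is a polyOver S & x = p.[v]) ->
    integral_over [set` V] a ->
    exists2 h : {poly K}, (forall i, I h`_i) & h.[v] = 1.
  move=> VP /integral_overP[n [p [Vp le_pn an]]].
  have /choice[f fP] i : exists q, q \is a polyOver S /\ p`_i = q.[v].
    by have [q] := VP _ (polyOverP Vp i); exists q.
  exists (\sum_(i < n) a^-1 ^+ (n - i) *: f i) => [j|].
    have I0 : I 0 by exists 0; rewrite ?rpred0 ?mulr0.
    rewrite coef_sum; elim/big_ind: _ => // i _; rewrite coefZ.
    rewrite mulrC; apply: IM; first exact/SR/polyOverP/(fP i).1.
    exists (a^-1 ^+ (n - i).-1); first by rewrite rpredX.
    by rewrite -exprS prednK // subn_gt0.
  have an0 : a ^+ n != 0 by rewrite expf_neq0.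
  apply: (mulfI an0); rewrite mulr1 {2}an (horner_coef_wide _ le_pn).
  rewrite horner_sum mulr_sumr; apply: eq_bigr => i _.
  rewrite hornerZ -(fP i).2 mulrA mulrC; congr (_ * _).
  by rewrite exprVn -expfB_cond ?(negPf a0) ?add0n ?leq_subr // subKn // ltnW.
have [h Ih hu] := step T u TP Ta.
have [k Ik ku] := step U u^-1 UP Ua.
have [y /RP[p Sp ->] /esym one] := chevalley_descent ID IM IR u0 Ih Ik hu ku.
apply/integral_overP; exists (size p), (\poly_(i < size p) p`_(size p - i.+1)).
split; [|exact: size_poly|].
  by apply/polyOver_poly => i _; apply: polyOverP.
rewrite (horner_coef_wide _ (size_poly _ _)) (reindex_inj rev_ord_inj) /=.
rewrite -[LHS]mulr1 -one horner_coef !mulr_sumr; apply: eq_bigr => i _.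
rewrite coef_poly ltn_subrL /= (leq_trans _ (ltn_ord i)) //.
rewrite subnSK // subKn 1?ltnW // expfB_cond ?(negPf a0) ?add0n //.
rewrite exprVn exprS invfM; ring.
Qed.

Lemma integral_over_morph (A K : comNzRingType) (pi : {rmorphism A -> K})
    (T : set A) (U : set K) (a : A) :
  (forall x, T x -> U (pi x)) -> integral_over T a -> integral_over U (pi a).
Proof.
move=> TU [q [qm Tq qa]]; exists (map_poly pi q); split.
- exact: monic_map.
- by move=> n; rewrite coef_map; apply: TU.
- exact: rmorph_root.
Qed.

(** Let S be maximal among the subrings containing B over which a is not integral,
and I the largest ideal of A inside S. Then K = A/I is a field, and the image O of
S is a valuation ring: if neither y nor 1/y is in O, maximality makes a integral
over O[y] and over O[1/y], hence over O, and this equation lifts to S because I is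
contained in S. *)
Theorem valuative_criterion (A : comNzRingType) (B : subringClosed A) (a : A) :
  (forall u : A, exists w, u * (1 - u * w) = 0) ->
  (forall (K : fieldType) (pi : {rmorphism A -> K}) (O : subringClosed K),
    (forall y, exists x, pi x = y) ->
    (forall y, (y \in O) || (y^-1 \in O)) ->
    (forall b, b \in B -> pi b \in O) -> pi a \in O) ->
  integral_over [set` B] a.
Proof.
move=> regular crit; apply: contrapT.
move=> /maximal_nonintegral_subring[S [BS Sa Smax]].
pose I x := forall v, x * v \in S.
have IS x : I x -> x \in S by move=> /(_ 1); rewrite mulr1.
have aS : a \notin S.
  apply/negP => aS; apply: Sa; apply/integral_overP; exists 1%N, a%:P.
  by rewrite polyOverC hornerC expr1 size_polyC; split=> //; case: eqP.
have [|v|x y Ix Iy v|x y Ix v|x|K [pi [pi_surj pi0]]] := @field_quotient A I.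
- by move=> I1; move/negP: aS; apply; rewrite -[a]mul1r; apply: I1.
- by rewrite mul0r rpred0.
- by rewrite mulrBl rpredB.
- by rewrite -mulrA.
- have [w xw0] := regular x.
  by have [Ix|Ix] := maximal_ideal_of_maximal_subring Sa Smax xw0; [left|right; exists w].
have [|||O OP] := @subringClosed_of K (fun y => exists2 s, s \in S & pi s = y).
- by exists 1; rewrite ?rpred1 ?rmorph1.
- by move=> _ _ [s Ss <-] [t St <-]; exists (s - t); rewrite ?rpredB ?rmorphB.
- by move=> _ _ [s Ss <-] [t St <-]; exists (s * t); rewrite ?rpredM ?rmorphM.
have piO x : pi x \in O -> x \in S.
  move=> /OP[s Ss /eqP]; rewrite -subr_eq0 -rmorphB => /eqP/pi0/IS Ssx.
  by rewrite -(subKr s x) rpredB.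
have SO x : x \in S -> pi x \in O by move=> Sx; apply/OP; exists x.
have extend u : u \notin S -> exists T : subringClosed K,
    (forall x, x \in T -> exists2 p, p \is a polyOver O & x = p.[pi u]) /\
    integral_over [set` T] (pi a).
  move=> Su; have [V VP] := adjoin_element S u.
  have SV : {subset S <= V}.
    by move=> s Ss; apply/VP; exists s%:P; rewrite ?polyOverC ?hornerC.
  have uV : u \in V by apply/VP; exists 'X; rewrite ?polyOverX ?hornerX.
  have [/(_ u uV)|Va] := Smax V SV; first by rewrite (negPf Su).
  have [T TP] := adjoin_element O (pi u); exists T; split=> [x /TP//|].
  apply: integral_over_morph Va => x /VP[p Sp ->]; apply/TP.
  exists (map_poly pi p); last by rewrite horner_map.
  by apply/polyOverP => i; rewrite coef_map; apply/SO/polyOverP.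
have Oval y : (y \in O) || (y^-1 \in O).
  have [->|y0] := eqVneq y 0; first by rewrite rpred0.
  have [[u yE] [u' yE']] := (pi_surj y, pi_surj y^-1).
  have [/SO|/extend[T [TP Ta]]] := boolP (u \in S); first by rewrite yE => ->.
  have [/SO|/extend[U [UP Ua]]] := boolP (u' \in S).
    by rewrite yE' => ->; rewrite orbT.
  exfalso; rewrite yE yE' in TP UP.
  have /integral_overP[n [p [Op le_pn an]]] := integral_over_adjoin y0 TP UP Ta Ua.
  have /choice[f fP] i : exists s, s \in S /\ pi s = p`_i.
    by have /OP[s] := polyOverP Op i; exists s.
  pose r := \poly_(i < n) f i.
  have Sr : r \is a polyOver S by apply/polyOver_poly => i _; case: (fP i).
  have pr : map_poly pi r = p.
    apply/polyP => i; rewrite coef_map coef_poly; case: ltnP => [_|le_ni].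
      exact: (fP i).2.
    by rewrite (nth_default _ (leq_trans le_pn le_ni)); exact: rmorph0.
  have : I (a ^+ n - r.[a]).
    by apply/pi0; rewrite rmorphB rmorphXn -horner_map pr an subrr.
  move=> /(_ a) Ica; apply: Sa; apply/integral_overP.
  exists n.+1, (r * 'X + ((a ^+ n - r.[a]) * a)%:P); split.
  - by rewrite rpredD ?rpredM ?polyOverX ?polyOverC.
  - by rewrite size_MXaddC; case: ifP => // _; rewrite ltnS size_poly.
  - by rewrite hornerMXaddC mulrBl -exprSr; ring.
by move/negP: aS; apply; apply/piO/(crit K) => // b /BS/SO.
Qed.

(** * Symmetric bilinear forms in three variables *)

Lemma sum3 (V : nmodType) (F : 'I_3 -> V) : \sum_i F i = F 0 + F 1 + F 2.
Proof.
rewrite !big_ord_recr big_ord0 /= add0r.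
by congr (F _ + F _ + F _); apply: val_inj.
Qed.

Lemma det3 (R : comNzRingType) (M : 'M[R]_3) :
  \det M = M 0 0 * (M 1 1 * M 2 2 - M 1 2 * M 2 1)
         - M 0 1 * (M 1 0 * M 2 2 - M 1 2 * M 2 0)
         + M 0 2 * (M 1 0 * M 2 1 - M 1 1 * M 2 0).
Proof.
pose f i j := M (inord i) (inord j).
have E i j : M i j = f (nat_of_ord i) (nat_of_ord j) by rewrite /f !inord_val.
rewrite (expand_det_row _ 0) sum3 /cofactor.
rewrite !(expand_det_row _ ord0) !big_ord_recl !big_ord0 /cofactor !det_mx11 !mxE !E.
rewrite /= /bump /= ?add0n ?addn0 ?addn1 ?add1n; ring.
Qed.

Section BilinearForm.
Variable K : fieldType.
Implicit Types (x y z : 'M[K]_3) (u v w : 'rV[K]_3) (c : K).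

Definition bform z u v : K := (u *m z *m v^T) 0 0.

Lemma bformDl z u v w : bform z (u + v) w = bform z u w + bform z v w.
Proof. by rewrite /bform !mulmxDl mxE. Qed.

Lemma bformDr z u v w : bform z w (u + v) = bform z w u + bform z w v.
Proof. by rewrite /bform linearD mulmxDr mxE. Qed.

Lemma bformZl z c u v : bform z (c *: u) v = c * bform z u v.
Proof. by rewrite /bform -!scalemxAl mxE. Qed.

Lemma bformZr z c u v : bform z u (c *: v) = c * bform z u v.
Proof. by rewrite /bform linearZ -scalemxAr mxE. Qed.

Lemma bformDm x y u v : bform (x + y) u v = bform x u v + bform y u v.
Proof. by rewrite /bform mulmxDr mulmxDl mxE. Qed.

Lemma bformZm c z u v : bform (c *: z) u v = c * bform z u v.
Proof. by rewrite /bform -scalemxAr -scalemxAl mxE. Qed.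

Lemma bformC z u v : z^T = z -> bform z u v = bform z v u.
Proof.
move=> zT; rewrite /bform.
have -> : u *m z *m v^T = (v *m z *m u^T)^T by rewrite !trmx_mul trmxK zT mulmxA.
by rewrite mxE.
Qed.

Definition bformE := (bformDl, bformDr, bformZl, bformZr, bformDm, bformZm).

Definition vol u v w : K :=
  u 0 0 * (v 0 1 * w 0 2 - v 0 2 * w 0 1)
  - u 0 1 * (v 0 0 * w 0 2 - v 0 2 * w 0 0)
  + u 0 2 * (v 0 0 * w 0 1 - v 0 1 * w 0 0).

(** The determinant of the Gram matrix of the symmetric form z on (u, v, w). *)
Definition gram z u v w : K :=
  bform z u u * (bform z v v * bform z w w - bform z v w ^+ 2)
  - bform z u v * (bform z u v * bform z w w - bform z v w * bform z u w)
  + bform z u w * (bform z u v * bform z v w - bform z v v * bform z u w).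

Definition basis_mx u v w : 'M[K]_3 :=
  \matrix_(i, j) (if i == 0 then u else if i == 1 then v else w) 0 j.

Lemma det_basis_mx u v w : \det (basis_mx u v w) = vol u v w.
Proof. by rewrite det3 !mxE. Qed.

Lemma basis_mx_bform z u v w (i j : 'I_3) :
  let e := fun k : 'I_3 => if k == 0 then u else if k == 1 then v else w in
  (basis_mx u v w *m z *m (basis_mx u v w)^T) i j = bform z (e i) (e j).
Proof.
move=> e; rewrite /bform !mxE; apply: eq_bigr => k _; rewrite !mxE.
by congr (_ * _); apply: eq_bigr => l _; rewrite !mxE.
Qed.

Lemma gram_det z u v w : z^T = z -> gram z u v w = vol u v w ^+ 2 * \det z.
Proof.
move=> zT; set M := basis_mx u v w.
have E : \det (M *m z *m M^T) = vol u v w * \det z * vol u v w.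
  by rewrite !det_mulmx det_tr det_basis_mx.
rewrite expr2 mulrAC -E det3 !basis_mx_bform /= /gram.
rewrite (bformC v u zT) (bformC w u zT) (bformC w v zT); ring.
Qed.

End BilinearForm.

(** * Valuation rings *)

Section ValuationRing.
Variables (K : fieldType) (O : subringClosed K).
Hypothesis O_val : forall a : K, (a \in O) || (a^-1 \in O).
Implicit Types (a b c : K).

Definition ounit a := [&& a != 0, a \in O & a^-1 \in O].

(** The valuation of a is at most that of b. *)
Definition odvd a b := exists2 c, c \in O & b = c * a.

Lemma odvd_total a b : odvd a b \/ odvd b a.
Proof.
have [->|a0] := eqVneq a 0; first by right; exists 0; rewrite ?rpred0 ?mul0r.
have [->|b0] := eqVneq b 0; first by left; exists 0; rewrite ?rpred0 ?mul0r.
have /orP[Oc|Oc] := O_val (b / a); first by left; exists (b / a); rewrite ?divfK.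
by right; exists (a / b); rewrite ?divfK // -invf_div.
Qed.

Lemma odvd_trans b a c : odvd a b -> odvd b c -> odvd a c.
Proof.
by move=> [x Ox ->] [y Oy ->]; exists (y * x); rewrite ?rpredM ?mulrA.
Qed.

Lemma odvd_min (T : eqType) (s : seq T) (f : T -> K) : s != [::] ->
  exists2 x, x \in s & forall y, y \in s -> odvd (f x) (f y).
Proof.
have refl a : odvd a a by exists 1; rewrite ?rpred1 ?mul1r.
elim: s => // x [|x' s] IHs _.
  by exists x => [|y]; rewrite inE // => /eqP->.
have [//|m ms mP] := IHs.
have [xm|mx] := odvd_total (f x) (f m).
  exists x => [|y]; rewrite inE ?eqxx // => /orP[/eqP->//|/mP].
  exact: odvd_trans.
by exists m => [|y]; rewrite inE ?ms ?orbT // => /orP[/eqP->//|/mP].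
Qed.

Lemma sqr_valuation a : a ^+ 2 \in O -> a \in O.
Proof.
move=> Oa2; have /orP[//|Oai] := O_val a.
have [->|a0] := eqVneq a 0; first by rewrite rpred0.
have -> : a = a ^+ 2 * a^-1 by rewrite expr2 mulfK.
by rewrite rpredM.
Qed.

Lemma ounit1 : ounit 1.
Proof. by rewrite /ounit oner_eq0 invr1 rpred1. Qed.

Lemma ounitN a : ounit (- a) = ounit a.
Proof. by rewrite /ounit oppr_eq0 invrN !rpredN. Qed.

Lemma ounitM a b : ounit a -> ounit b -> ounit (a * b).
Proof.
move=> /and3P[a0 Oa Oa'] /and3P[b0 Ob Ob']; rewrite /ounit mulf_neq0 //.
by rewrite invfM !rpredM.
Qed.

Lemma ounitMl a b : a \in O -> b \in O -> ounit (a * b) -> ounit a.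
Proof.
move=> Oa Ob /and3P[]; rewrite mulf_eq0 => /norP[a0 b0] _ Oab.
rewrite /ounit a0 Oa.
have -> : a^-1 = b * (a * b)^-1 by rewrite invfM mulrCA mulfV ?mulr1.
exact: rpredM.
Qed.

(** The non-units of a valuation ring are closed under addition. *)
Lemma ounitD a b : a \in O -> b \in O -> ounit (a + b) -> ounit a \/ ounit b.
Proof.
move=> Oa Ob /and3P[ab0 _ Oab].
have [[c Oc bE]|[c Oc aE]] := odvd_total a b; [left|right].
  apply: (@ounitMl a (1 + c)); rewrite ?rpredD ?rpred1 //.
  have -> : a * (1 + c) = a + b by rewrite bE; ring.
  by rewrite /ounit ab0 rpredD.
apply: (@ounitMl b (1 + c)); rewrite ?rpredD ?rpred1 //.
have -> : b * (1 + c) = a + b by rewrite aE; ring.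
by rewrite /ounit ab0 rpredD.
Qed.

Lemma ounit_sqr a : ounit (a ^+ 2) -> ounit a.
Proof.
move=> a2; have /and3P[_ /sqr_valuation Oa _] := a2.
by apply: (@ounitMl a a).
Qed.

End ValuationRing.

(** * Bases adapted to a module of forms with integral determinants *)

Ltac O_closed :=
  repeat first [ assumption | exact: rpred1 | exact: rpred_nat | match goal with
    | |- is_true (_ + _ \in _) => apply: rpredD
    | |- is_true (- _ \in _) => rewrite rpredN
    | |- is_true (_ * _ \in _) => apply: rpredM
    | |- is_true (_ ^+ _ \in _) => apply: rpredX
  end ].

Section IntegralBasis.
Variables (K : fieldType) (O : subringClosed K).
Hypothesis O_val : forall a : K, (a \in O) || (a^-1 \in O).
Hypothesis two_neq0 : 2 != 0 :> K.
Hypothesis O_half : 2^-1 \in O.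
Hypothesis K_sqrt : forall a : K, exists r, r ^+ 2 = a.
Variable L : 'M[K]_3 -> Prop.
Hypothesis L_lin : forall c x y, c \in O -> L x -> L y -> L (c *: x + y).
Hypothesis L_sym : forall z, L z -> z^T = z.
Hypothesis L_det : forall z, L z -> \det z \in O.
Implicit Types (x y z : 'M[K]_3) (u v w : 'rV[K]_3) (s : seq 'M[K]_3).

Definition integral z u v w : bool :=
  [&& bform z u u \in O, bform z u v \in O, bform z u w \in O,
      bform z v v \in O, bform z v w \in O & bform z w w \in O].

(** The conclusion aimed at: a unimodular change of basis makes all forms of s
integral. *)
Definition adapted s := exists u v w,
  vol u v w = 1 /\ forall z, z \in s -> integral z u v w.

Definition lattice u v w (x : 'rV[K]_3) := exists a b c,
  [/\ a \in O, b \in O, c \in O & x = a *: u + b *: v + c *: w].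

Lemma latticeD u v w v1 v2 :
  lattice u v w v1 -> lattice u v w v2 -> lattice u v w (v1 + v2).
Proof.
move=> [a [b [c [Oa Ob Oc ->]]]] [a' [b' [c' [Oa' Ob' Oc' ->]]]].
exists (a + a'), (b + b'), (c + c'); split; rewrite ?rpredD //.
by rewrite !scalerDl addrACA (addrACA (a *: u)).
Qed.

Lemma latticeZ u v w c v1 :
  c \in O -> lattice u v w v1 -> lattice u v w (c *: v1).
Proof.
move=> Oc [a [b [d [Oa Ob Od ->]]]].
exists (c * a), (c * b), (c * d); split; rewrite ?rpredM //.
by rewrite !scalerDr !scalerA.
Qed.

Lemma lattice_basis u v w :
  [/\ lattice u v w u, lattice u v w v & lattice u v w w].
Proof.
split; [exists 1, 0, 0|exists 0, 1, 0|exists 0, 0, 1];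
  by rewrite !scale0r ?scale1r ?addr0 ?add0r ?rpred0 ?rpred1.
Qed.

Lemma lattice1 u v w : lattice u v w u.
Proof. by have [] := lattice_basis u v w. Qed.
Lemma lattice2 u v w : lattice u v w v.
Proof. by have [] := lattice_basis u v w. Qed.
Lemma lattice3 u v w : lattice u v w w.
Proof. by have [] := lattice_basis u v w. Qed.
Hint Resolve lattice1 lattice2 lattice3 : core.

Ltac lattice_closed :=
  repeat first [ assumption | exact: lattice1 | exact: lattice2 | exact: lattice3
    | apply: latticeD | apply: latticeZ ]; O_closed.

Lemma bform_lattice z u v w v1 v2 : L z -> integral z u v w ->
  lattice u v w v1 -> lattice u v w v2 -> bform z v1 v2 \in O.
Proof.
move=> /L_sym zT /and5P[uu uv uw vv /andP[vw ww]].
move=> [a [b [c [Oa Ob Oc ->]]]] [a' [b' [c' [Oa' Ob' Oc' ->]]]].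
rewrite !bformE (bformC v u zT) (bformC w u zT) (bformC w v zT).
by rewrite !(rpredD, rpredM).
Qed.

Lemma integral_lattice z u v w u' v' w' : L z -> integral z u v w ->
  lattice u v w u' -> lattice u v w v' -> lattice u v w w' ->
  integral z u' v' w'.
Proof.
by move=> Lz Iz lu lv lw; rewrite /integral !(bform_lattice Lz Iz).
Qed.

Lemma integral_lin c x y u v w : c \in O -> integral x u v w ->
  integral y u v w -> integral (c *: x + y) u v w.
Proof.
move=> Oc /and5P[? ? ? ? /andP[? ?]] /and5P[? ? ? ? /andP[? ?]].
by rewrite /integral !bformE !(rpredD, rpredM).
Qed.

Lemma L_D x y : L x -> L y -> L (x + y).
Proof. by move=> Lx Ly; rewrite -[x]scale1r; apply: L_lin; rewrite ?rpred1. Qed.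

Lemma L_B x y : L x -> L y -> L (x - y).
Proof.
by move=> Lx Ly; rewrite addrC -scaleN1r; apply: L_lin; rewrite ?rpredN1.
Qed.

(** The form y is 2 X1 X2 + e X3^2 in the basis (u, v, w). *)
Definition hyperbolic y u v w :=
  [/\ bform y u u = 0, bform y u v = 1, bform y u w = 0, bform y v v = 0
    & bform y v w = 0].

Lemma O_twice a : 2 * a \in O -> a \in O.
Proof.
by move=> O2a; rewrite -[a](mulKf two_neq0) rpredM.
Qed.

Section Hyperbolic.
Variables (u v w : 'rV[K]_3) (y : 'M[K]_3).
Let D := vol u v w.
Hypothesis D0 : D != 0.
Hypothesis Ly : L y.
Hypothesis Iy : integral y u v w.
Hypothesis Hy : hyperbolic y u v w.

(* J is the fractional ideal D^2 O, which contains all Gram determinants of L. *)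
Let J (a : K) := a / D ^+ 2 \in O.

Let JD a b : J a -> J b -> J (a + b).
Proof. by rewrite /J mulrDl; apply: rpredD. Qed.

Let JM c a : c \in O -> J a -> J (c * a).
Proof. by rewrite /J -mulrA; apply: rpredM. Qed.

Let JN a : J a -> J (- a).
Proof. by rewrite /J mulNr rpredN. Qed.

Let J_twice a : J (2 * a) -> J a.
Proof. by rewrite /J -mulrA; apply: O_twice. Qed.

Ltac J_closed :=
  repeat first [ assumption | match goal with
    | |- is_true (J (_ + _)) => apply: JD
    | |- is_true (J (- _)) => apply: JN
    | |- is_true (J (_ * _)) => apply: JM
  end ]; O_closed.

Let J_gram z : L z -> J (gram z u v w).
Proof.
move=> Lz; rewrite /J (gram_det _ _ _ (L_sym Lz)) mulrAC mulfV ?mul1r ?L_det //.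
by rewrite expf_neq0.
Qed.

(** The three conditions come from the coefficients of t^2, t and 1 in the
determinant of t y + z, extracted from t = 1, -1, 0 and from det y = - e: up to
terms already known to be in D^2 O, they are - z(w,w), 2 z(u,w) z(v,w) and minus
the last expression. *)
Lemma hyperbolic_relations z : L z -> integral z u v w ->
  [/\ J (bform z w w), J (bform z u w * bform z v w)
    & J (bform z u u * bform z v w ^+ 2 + bform z v v * bform z u w ^+ 2)].
Proof.
move=> Lz Iz; have /and5P[zuu zuv zuw zvv /andP[zvw zww]] := Iz.
have [yuu yuv yuw yvv yvw] := Hy; have /and5P[_ _ _ _ /andP[_ yww]] := Iy.
have J0 := J_gram Ly; have Jz := J_gram Lz.
have Jp := J_gram (L_D Ly Lz); have Jm := J_gram (L_B Ly Lz).
have Je : J (bform y w w).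
  have -> : bform y w w = - gram y u v w; last exact: JN.
  by rewrite /gram yuu yuv yuw yvv yvw; ring.
have bformB a b : bform (y - z) a b = bform y a b - bform z a b.
  by rewrite bformDm -scaleN1r bformZm mulN1r.
have Jww : J (bform z w w).
  apply: J_twice.
  have -> : 2 * bform z w w = (gram (y - z) u v w - gram (y + z) u v w)
      + 2 * gram z u v w + (- (4 * bform z u v) * bform y w w).
    by rewrite /gram !bformB !bformDm yuu yuv yuw yvv yvw; ring.
  by J_closed.
have Jab : J (bform z u w * bform z v w).
  apply/J_twice/J_twice.
  have -> : 2 * (2 * (bform z u w * bform z v w)) =
      (gram (y - z) u v w + gram (y + z) u v w) - 2 * gram y u v w
      + (4 * bform z u v) * bform z w w
      + (- (2 * (bform z u u * bform z v v - bform z u v ^+ 2))) * bform y w w.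
    by rewrite /gram !bformB !bformDm yuu yuv yuw yvv yvw; ring.
  by J_closed.
split=> //.
have -> : bform z u u * bform z v w ^+ 2 + bform z v v * bform z u w ^+ 2 =
    - gram z u v w + (bform z u u * bform z v v - bform z u v ^+ 2) * bform z w w
    + (2 * bform z u v) * (bform z u w * bform z v w).
  by rewrite /gram; ring.
by J_closed.
Qed.

(** Let a = z(u,w) and b = z(v,w) have minimal valuations, that of a being at most
that of b. The relations give ab in D^2 O, then b^2 in D^2 O, and finally
a^2 z(v,v) in D^2 O for all z. Hence the basis (t u, v/t, w/D), of volume 1, makes
all forms integral for t = 1 if D divides a, and for t = D/a if a divides D. *)
Lemma hyperbolic_adapted_wlog s za zb :
  (forall z, z \in s -> L z /\ integral z u v w) -> za \in s -> zb \in s ->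
  (forall z, z \in s -> odvd O (bform za u w) (bform z u w)) ->
  (forall z, z \in s -> odvd O (bform zb v w) (bform z v w)) ->
  odvd O (bform za u w) (bform zb v w) ->
  adapted s.
Proof.
move=> sL sa sb amin bmin; set a := bform za u w; set b := bform zb v w => ab.
have [La Ia] := sL za sa; have [Lb Ib] := sL zb sb.
have lin c x z : c \in O -> x \in s -> z \in s ->
    L (c *: x + z) /\ integral (c *: x + z) u v w.
  move=> Oc /sL[Lx Ix] /sL[Lz Iz]; split; [exact: L_lin|exact: integral_lin].
(* The minima may be attained at different forms za and zb; the relation for
   their sum then controls the product a b. *)
have Jab : J (a * b).
  have [q Oq bE] := bmin za sa; have [r Or aE] := amin zb sb.
  have [_ Ja _] := hyperbolic_relations La Ia.
  have [_ Jb _] := hyperbolic_relations Lb Ib.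
  have [Lab Iab] := lin 1 za zb (rpred1 _) sa sb.
  have [_ Jc _] := hyperbolic_relations Lab Iab.
  move: Ja Jb Jc; rewrite !bformDm !bformZm !mul1r -/a -/b bE aE -/a -/b.
  move=> Ja Jb Jc.
  have -> : a * b = (a + r * a) * (q * b + b) - a * (q * b) - r * a * b
      - r * (a * (q * b)) by ring.
  by J_closed.
have Jbb z : z \in s -> J (bform z v w ^+ 2).
  move=> /bmin[c Oc ->]; have [d Od bE] := ab; rewrite -/a -/b in bE *.
  have -> : (c * b) ^+ 2 = (c ^+ 2 * d) * (a * b) by rewrite bE; ring.
  by J_closed.
have Jaa z : z \in s -> J (bform z v v * bform z u w ^+ 2).
  move=> sz; have [Lz Iz] := sL z sz; have [_ _ Jz] := hyperbolic_relations Lz Iz.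
  have /and5P[zuu _ _ _ _] := Iz.
  rewrite -[X in J X](addKr (bform z u u * bform z v w ^+ 2)).
  by move: (Jbb z sz) => ?; J_closed.
have Jlin c z : c \in O -> z \in s ->
    J (bform (c *: za + z) v v * bform (c *: za + z) u w ^+ 2).
  move=> Oc sz; have [Lc Ic] := lin c za z Oc sa sz.
  have [_ _ Jz] := hyperbolic_relations Lc Ic; have /and5P[cuu _ _ _ _] := Ic.
  set x := _ + z in Jz cuu *.
  rewrite -[X in J X](addKr (bform x u u * bform x v w ^+ 2)).
  apply: JD => //; apply: JN; apply: JM => //; rewrite bformDm bformZm.
  have [p Op ->] := bmin za sa; have [q Oq ->] := bmin z sz.
  rewrite -/b; have [d Od bE] := ab; rewrite -/a -/b in bE.
  have -> : (c * (p * b) + q * b) ^+ 2 = ((c * p + q) ^+ 2 * d) * (a * b).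
    by rewrite bE; ring.
  by J_closed.
(* Polarization of the last relation between za and z, through za + z and z - za. *)
have Jaav z : z \in s -> J (a ^+ 2 * bform z v v).
  move=> sz; have Jp := Jlin 1 z (rpred1 _) sz.
  have Jm := Jlin (-1) z (rpredN1 _) sz.
  have Ja := Jaa za sa; have Jz := Jaa z sz; have [c Oc cE] := amin z sz.
  rewrite -/a in Ja cE; rewrite !bformDm !bformZm cE -/a in Jp Jm Jz.
  apply: J_twice.
  have -> : 2 * (a ^+ 2 * bform z v v) =
    ((1 * bform za v v + bform z v v) * (1 * a + c * a) ^+ 2
     + (-1 * bform za v v + bform z v v) * (-1 * a + c * a) ^+ 2)
    - 2 * (bform z v v * (c * a) ^+ 2)
    - (4 * c) * (bform za v v * a ^+ 2) by ring.
  by J_closed.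
have zww z : z \in s -> bform z (D^-1 *: w) (D^-1 *: w) \in O.
  move=> sz; have [Lz Iz] := sL z sz; have [Jz _ _] := hyperbolic_relations Lz Iz.
  rewrite bformZl bformZr mulrA -expr2 exprVn mulrC; exact: Jz.
have [[c Oc aE]|[t Ot DE]] := odvd_total O_val D a.
  exists u, v, (D^-1 *: w); split=> [|z sz].
    by rewrite -(mulVf D0) /D /vol !mxE; ring.
  have [Lz Iz] := sL z sz; have /and5P[zuu zuv _ zvv _] := Iz.
  rewrite /integral zuu zuv zvv zww // !bformZr /=.
  have [r Or ->] := amin z sz; have [q Oq ->] := bmin z sz.
  have [d Od bE] := ab; rewrite -/a -/b aE in bE *.
  rewrite mulrA mulrCA mulVf // mulr1 rpredM //= bE.
  have -> : D^-1 * (q * (d * (c * D))) = q * d * c * (D^-1 * D) by ring.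
  by rewrite mulVf // mulr1 !rpredM.
have a0 : a != 0 by apply: contraNneq D0 => a0; rewrite DE a0 mulr0.
have t0 : t != 0 by apply: contraNneq D0 => t0; rewrite DE t0 mul0r.
exists (t *: u), (t^-1 *: v), (D^-1 *: w); split=> [|z sz].
  have -> : vol (t *: u) (t^-1 *: v) (D^-1 *: w) = (t * t^-1) * (D^-1 * D).
    by rewrite /D /vol !mxE; ring.
  by rewrite mulfV // mulVf // mulr1.
have [Lz Iz] := sL z sz; have /and5P[zuu zuv _ _ _] := Iz.
have tV : t^-1 = a / D by rewrite DE invfM mulrCA mulfV ?mulr1.
rewrite /integral zww // !bformZr !bformZl andbT.
apply/and5P; split.
- by rewrite !rpredM.
- by rewrite mulrA mulVf // mul1r.
- have [r Or ->] := amin z sz; rewrite -/a.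
  have -> : D^-1 * (t * (r * a)) = r * (D^-1 * (t * a)) by ring.
  by rewrite -DE mulVf // mulr1.
- rewrite tV; have -> : a / D * (a / D * bform z v v) = a ^+ 2 * bform z v v / D ^+ 2.
    by field.
  exact: Jaav.
- have [q Oq ->] := bmin z sz; rewrite -/b tV.
  have -> : D^-1 * (a / D * (q * b)) = q * (a * b / D ^+ 2) by field.
  by rewrite rpredM.
Qed.

End Hyperbolic.

Lemma hyperbolic_adapted u v w y s :
  vol u v w != 0 -> L y -> integral y u v w -> hyperbolic y u v w ->
  (forall z, z \in s -> L z /\ integral z u v w) -> adapted s.
Proof.
move=> D0 Ly Iy Hy sL.
have [->|s0] := eqVneq s [::].
  exists u, v, ((vol u v w)^-1 *: w); split=> //.
  by rewrite -(mulVf D0) /vol !mxE; ring.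
have [za sa amin] := odvd_min O_val (fun z => bform z u w) s0.
have [zb sb bmin] := odvd_min O_val (fun z => bform z v w) s0.
have [ab|ba] := odvd_total O_val (bform za u w) (bform zb v w).
  exact: (hyperbolic_adapted_wlog D0 Ly Iy Hy sL sa sb).
have swap z : L z -> integral z u v w -> integral z v u w.
  by move=> Lz Iz; apply: (integral_lattice Lz Iz).
have [yuu yuv yuw yvv yvw] := Hy.
apply: (@hyperbolic_adapted_wlog v u w y _ _ _ _ s zb za) => //.
- have -> : vol v u w = - vol u v w by rewrite /vol; ring.
  by rewrite oppr_eq0.
- exact: swap.
- by split=> //; rewrite (bformC _ _ (L_sym Ly)).
- by move=> z /sL[Lz Iz]; split=> //; apply: swap.
Qed.

(** An integral form with an isotropic basis vector that pairs to a unit with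
another one splits off an integral hyperbolic plane. *)
Lemma isotropic_adapted u v w y s :
  vol u v w != 0 -> L y -> integral y u v w ->
  bform y u u = 0 -> ounit O (bform y u v) ->
  (forall z, z \in s -> L z /\ integral z u v w) -> adapted s.
Proof.
move=> D0 Ly Iy yuu /and3P[e0 Oe Oe'] sL; set e := bform y u v in e0 Oe Oe'.
have yT := L_sym Ly; have /and5P[_ _ Ouw Ovv /andP[Ovw _]] := Iy.
pose v' := e^-1 *: v - (2^-1 * e^-2 * bform y v v) *: u.
pose w' := w - bform y u w *: v' - bform y v' w *: u.
have Oc : 2^-1 * e^-2 * bform y v v \in O by rewrite -exprVn; O_closed.
have lv : lattice u v w v' by rewrite /v' -scaleNr; lattice_closed.
have Ov'w : bform y v' w \in O by apply: (bform_lattice Ly Iy).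
have lw : lattice u v w w'.
  by rewrite /w' -!scaleNr; lattice_closed.
have bformB a b c d : bform y (a - b *: c) d = bform y a d - b * bform y c d.
  by rewrite -scaleNr !bformE mulNr.
have bformBr a b c d : bform y d (a - b *: c) = bform y d a - b * bform y d c.
  by rewrite -scaleNr !bformE mulNr.
have Huv : bform y u v' = 1 by rewrite bformBr bformZr yuu -/e mulVf // mulr0 subr0.
have Hvu : bform y v' u = 1 by rewrite (bformC _ _ yT).
have Hvv : bform y v' v' = 0.
  rewrite [LHS]bformBr bformZr Hvu bformB bformZl -/e.
  by field; rewrite e0 two_neq0.
have Hw d : bform y d w' =
    bform y d w - bform y u w * bform y d v' - bform y v' w * bform y d u.
  by rewrite [LHS]bformBr [X in X - _]bformBr.
apply: (@hyperbolic_adapted u v' w' y) => //.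
- have -> : vol u v' w' = e^-1 * vol u v w by rewrite /vol !mxE; ring.
  by rewrite mulf_neq0 ?invr_eq0.
- exact: (integral_lattice Ly Iy).
- split=> //.
    by rewrite Hw Huv yuu mulr1 mulr0 subr0 subrr.
  by rewrite Hw Hvv Hvu mulr1 mulr0 subr0 subrr.
- by move=> z /sL[Lz Iz]; split=> //; apply: (integral_lattice Lz Iz).
Qed.

(** The vectors u + k v and u - k v are isotropic when k^2 y(v,v) = -1. *)
Lemma binary_adapted_wlog u v w y s :
  vol u v w != 0 -> L y -> integral y u v w ->
  bform y u u = 1 -> bform y u v = 0 -> ounit O (bform y v v) ->
  (forall z, z \in s -> L z /\ integral z u v w) -> adapted s.
Proof.
move=> D0 Ly Iy yuu yuv /and3P[e0 Oe Oe'] sL; set e := bform y v v in e0 Oe Oe'.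
have [k kE] := K_sqrt (- e^-1).
have Ok : k \in O by apply: (sqr_valuation O_val); rewrite kE rpredN.
have k0 : k != 0.
  by apply: contraNneq e0 => k0; rewrite -invr_eq0 -oppr_eq0 -kE k0 expr0n.
have ke : k ^+ 2 * e = -1 by rewrite kE mulNr mulVf.
have yT := L_sym Ly.
apply: (@isotropic_adapted (u + k *: v) (u + (- k) *: v) w y) => //.
- have -> : vol (u + k *: v) (u + (- k) *: v) w = - (2 * k) * vol u v w.
    by rewrite /vol !mxE; ring.
  by rewrite mulf_neq0 // oppr_eq0 mulf_neq0.
- by apply: (integral_lattice Ly Iy); lattice_closed.
- rewrite !bformE yuu (bformC v u yT) yuv -/e.
  by transitivity (1 + k ^+ 2 * e); [ring | rewrite ke subrr].
- rewrite !bformE yuu (bformC v u yT) yuv -/e.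
  set a := (X in ounit O X); have -> : a = 1 - k ^+ 2 * e by rewrite /a; ring.
  by rewrite ke opprK -[1 + 1]/(2%:R) /ounit two_neq0 O_half rpred_nat.
- by move=> z /sL[Lz Iz]; split=> //; apply: (integral_lattice Lz Iz); lattice_closed.
Qed.

(** If y(v,w) is a unit while y(v,v) and y(w,w) are not, then v + w can replace v. *)
Lemma binary_adapted u v w y s :
  vol u v w != 0 -> L y -> integral y u v w ->
  bform y u u = 1 -> bform y u v = 0 -> bform y u w = 0 ->
  [\/ ounit O (bform y v v), ounit O (bform y v w) | ounit O (bform y w w)] ->
  (forall z, z \in s -> L z /\ integral z u v w) -> adapted s.
Proof.
move=> D0 Ly Iy yuu yuv yuw yunit sL; have yT := L_sym Ly.
have /and5P[_ _ _ Ovv /andP[Ovw Oww]] := Iy.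
have [yvv|yvv] := boolP (ounit O (bform y v v)).
  exact: (@binary_adapted_wlog u v w y).
have [yww|yww] := boolP (ounit O (bform y w w)).
  apply: (@binary_adapted_wlog u w v y) => //.
  - have -> : vol u w v = - vol u v w by rewrite /vol; ring.
    by rewrite oppr_eq0.
  - exact: (integral_lattice Ly Iy).
  - by move=> z /sL[Lz Iz]; split=> //; apply: (integral_lattice Lz Iz).
have yvw : ounit O (bform y v w).
  by case: yunit => //; [rewrite (negPf yvv)|rewrite (negPf yww)].
apply: (@binary_adapted_wlog u (v + w) w y) => //.
- by have -> : vol u (v + w) w = vol u v w by rewrite /vol !mxE; ring.
- by apply: (integral_lattice Ly Iy); lattice_closed.
- by rewrite bformDr yuv yuw addr0.
- rewrite !bformE (bformC w v yT).
  have O2 : ounit O (2 * bform y v w).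
    apply: ounitM => //; rewrite /ounit two_neq0 O_half andbT; exact: rpred_nat.
  have E : 2 * bform y v w =
      (bform y v v + bform y v w + (bform y v w + bform y w w))
      + (- bform y v v - bform y w w) by ring.
  have O1 : bform y v v + bform y v w + (bform y v w + bform y w w) \in O by O_closed.
  have O3 : - bform y v v - bform y w w \in O by O_closed.
  rewrite E in O2; have [//|O4] := ounitD O_val O1 O3 O2.
  have Ovv' : - bform y v v \in O by O_closed.
  have Oww' : - bform y w w \in O by O_closed.
  by case: (ounitD O_val Ovv' Oww' O4); rewrite ounitN ?(negPf yvv) ?(negPf yww).
- by move=> z /sL[Lz Iz]; split=> //; apply: (integral_lattice Lz Iz); lattice_closed.
Qed.

(** If z(u,v) or z(u,w) is a unit, then z splits off a hyperbolic plane; if y has a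
unit in its lower block, then y does; otherwise y + z does, since clearing its
first row leaves a lower block that differs from that of z by non-units. *)
Lemma complement_adapted u v w y z s :
  vol u v w != 0 -> L y -> L z -> integral y u v w -> integral z u v w ->
  bform y u u = 1 -> bform y u v = 0 -> bform y u w = 0 -> bform z u u = 0 ->
  [\/ ounit O (bform z v v), ounit O (bform z v w) | ounit O (bform z w w)] ->
  (forall x, x \in s -> L x /\ integral x u v w) -> adapted s.
Proof.
move=> D0 Ly Lz Iy Iz yuu yuv yuw zuu zunit sL.
have yT := L_sym Ly; have zT := L_sym Lz.
have /and5P[_ Ouv Ouw Ovv /andP[Ovw Oww]] := Iz.
have [zuv|zuv] := boolP (ounit O (bform z u v)).
  exact: (@isotropic_adapted u v w z).
have [zuw|zuw] := boolP (ounit O (bform z u w)).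
  apply: (@isotropic_adapted u w v z) => //.
  - have -> : vol u w v = - vol u v w by rewrite /vol; ring.
    by rewrite oppr_eq0.
  - exact: (integral_lattice Lz Iz).
  - by move=> x /sL[Lx Ix]; split=> //; apply: (integral_lattice Lx Ix).
have [yunit|yunit] := pselect
    [\/ ounit O (bform y v v), ounit O (bform y v w) | ounit O (bform y w w)].
  exact: (@binary_adapted u v w y).
pose v' := v + (- bform z u v) *: u; pose w' := w + (- bform z u w) *: u.
have lv : lattice u v w v' by lattice_closed.
have lw : lattice u v w w' by lattice_closed.
have /and5P[_ _ _ Yvv /andP[Yvw Yww]] := Iy.
have unit_of a b c d : a \in O -> b \in O -> c \in O -> d \in O ->
    ounit O b -> ~~ ounit O a -> ~~ ounit O c -> ounit O (a + b - c * d).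
  move=> Oa Ob Oc Od; have {1}-> : b = (a + b - c * d) + (c * d - a) by ring.
  move=> /(ounitD O_val)[||//|]; [O_closed|O_closed|].
  move=> /(ounitD O_val)[||/ounitMl ucd|]; [O_closed|O_closed| |].
    by move=> _ /negP; case; apply: ucd.
  by rewrite ounitN => ->.
apply: (@binary_adapted u v' w' (y + z)) => //.
- by have -> : vol u v' w' = vol u v w by rewrite /vol !mxE; ring.
- exact: L_D.
- have Lyz := L_D Ly Lz; apply: (integral_lattice Lyz _ (lattice1 _ _ _) lv lw).
  by rewrite -[y]scale1r integral_lin ?rpred1.
- by rewrite bformDm yuu zuu addr0.
- by rewrite !bformE yuu yuv zuu; ring.
- by rewrite !bformE yuu yuw zuu; ring.
- have Evv : bform (y + z) v' v' =
      bform y v v + bform z v v - bform z u v * bform z u v.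
    by rewrite !bformE yuu (bformC v u yT) (bformC v u zT) yuv zuu; ring.
  have Evw : bform (y + z) v' w' =
      bform y v w + bform z v w - bform z u v * bform z u w.
    by rewrite !bformE yuu (bformC v u yT) (bformC v u zT) yuv yuw zuu; ring.
  have Eww : bform (y + z) w' w' =
      bform y w w + bform z w w - bform z u w * bform z u w.
    by rewrite !bformE yuu (bformC w u yT) (bformC w u zT) yuw zuu; ring.
  rewrite Evv Evw Eww; case: zunit => ?; [constructor 1|constructor 2|constructor 3];
    apply: unit_of => //; apply/negP => ?; apply: yunit;
    by [constructor 1|constructor 2|constructor 3].
- by move=> x /sL[Lx Ix]; split=> //; apply: (integral_lattice Lx Ix).
Qed.

(** Let d have minimal valuation among the values at (v,v), (v,w) and (w,w) of all
forms and the squares of z(u,v) and z(u,w) for z in s; these numbers bound all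
2x2 minors. Dividing v and w by a square root of d makes all forms integral and
creates a unit among these numbers, hence a form that splits off a hyperbolic
plane. If d = 0, only y(u,u) is nonzero. *)
Lemma normalized_adapted u v w y s :
  vol u v w != 0 -> L y ->
  bform y u u = 1 -> bform y u v = 0 -> bform y u w = 0 ->
  (forall z, z \in s -> L z /\ bform z u u = 0) -> adapted (y :: s).
Proof.
move=> D0 Ly yuu yuv yuw sL; have yT := L_sym Ly.
pose minors z := [:: bform z v v; bform z v w; bform z w w].
pose borders z := [:: bform z u v ^+ 2; bform z u w ^+ 2].
pose vals := flatten [seq minors z | z <- y :: s] ++ flatten [seq borders z | z <- s].
have vals_minor z a : z \in y :: s -> a \in minors z -> a \in vals.
  by move=> sz za; rewrite mem_cat; apply/orP; left; apply/flatten_mapP; exists z.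
have vals_border z a : z \in s -> a \in borders z -> a \in vals.
  by move=> sz za; rewrite mem_cat; apply/orP; right; apply/flatten_mapP; exists z.
have [|d vd dmin] := @odvd_min _ _ O_val _ vals id; first by [].
have [d0|d0] := eqVneq d 0.
  have vals0 a : a \in vals -> a = 0.
    by move=> /dmin[c _ ->]; rewrite /= d0 mulr0.
  exists u, v, ((vol u v w)^-1 *: w); split=> [|z].
    by rewrite -(mulVf D0) /vol !mxE; ring.
  move=> sz; have zvv : bform z v v = 0.
    by apply/vals0/(vals_minor z); rewrite // !inE eqxx.
  have zvw : bform z v w = 0.
    by apply/vals0/(vals_minor z); rewrite // !inE eqxx ?orbT.
  have zww : bform z w w = 0.
    by apply/vals0/(vals_minor z); rewrite // !inE eqxx ?orbT.
  rewrite /integral !(bformZl, bformZr) zvv zvw zww !mulr0 rpred0 !andbT.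
  move: sz; rewrite inE => /orP[/eqP->|sz].
    by rewrite yuu yuv yuw mulr0 rpred0 rpred1.
  have [_ ->] := sL z sz.
  have /eqP : bform z u v ^+ 2 = 0.
    by apply/vals0/(vals_border z); rewrite // !inE eqxx.
  have /eqP : bform z u w ^+ 2 = 0.
    by apply/vals0/(vals_border z); rewrite // !inE eqxx orbT.
  by rewrite !sqrf_eq0 => /eqP-> /eqP->; rewrite mulr0 rpred0.
have [r rE] := K_sqrt d.
have r0 : r != 0 by apply: contraNneq d0 => r0; rewrite -rE r0 expr0n.
pose v' := r^-1 *: v; pose w' := r^-1 *: w.
have D0' : vol u v' w' != 0.
  have -> : vol u v' w' = d^-1 * vol u v w.
    by rewrite -rE -exprVn /vol !mxE; ring.
  by rewrite mulf_neq0 ?invr_eq0.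
have Od a : a \in vals -> a / d \in O by move=> /dmin[c Oc /= ->]; rewrite mulfK.
have scale z a b : bform z (r^-1 *: a) (r^-1 *: b) = bform z a b / d.
  by rewrite bformZl bformZr mulrA -expr2 exprVn rE mulrC.
have sqr_border z a : bform z u (r^-1 *: a) ^+ 2 = bform z u a ^+ 2 / d.
  by rewrite bformZr exprMn exprVn rE mulrC.
have Iminor z : z \in y :: s ->
    [&& bform z v' v' \in O, bform z v' w' \in O & bform z w' w' \in O].
  move=> sz; rewrite !scale; apply/and3P.
  by split; apply/Od/(vals_minor z) => //; rewrite !inE eqxx ?orbT.
have Iborder z : z \in s -> (bform z u v' \in O) && (bform z u w' \in O).
  move=> sz; apply/andP; split; apply: (sqr_valuation O_val); rewrite sqr_border;
    by apply/Od/(vals_border z) => //; rewrite !inE eqxx ?orbT.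
have Iy : integral y u v' w'.
  have /and3P[Ivv Ivw Iww] := Iminor y (mem_head _ _).
  by rewrite /integral Ivv Ivw Iww yuu !bformZr yuv yuw mulr0 rpred0 rpred1.
have Is z : z \in s -> integral z u v' w'.
  move=> sz; have /and3P[Ivv Ivw Iww] := Iminor z (mem_behead (s := y :: s) sz).
  have /andP[Iuv Iuw] := Iborder z sz; have [_ zuu] := sL z sz.
  by rewrite /integral zuu rpred0 Iuv Iuw Ivv Ivw Iww.
have sL' z : z \in y :: s -> L z /\ integral z u v' w'.
  by rewrite inE => /orP[/eqP->//|sz]; split; [case: (sL z sz)|apply: Is].
have dd : ounit O (d / d) by rewrite mulfV // ounit1.
have yuv' : bform y u v' = 0 by rewrite bformZr yuv mulr0.
have yuw' : bform y u w' = 0 by rewrite bformZr yuw mulr0.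
have unit_minor z : d \in minors z -> [\/ ounit O (bform z v' v'),
    ounit O (bform z v' w') | ounit O (bform z w' w')].
  rewrite !inE !scale => /or3P[] /eqP <-; by [constructor 1|constructor 2|constructor 3].
move: vd; rewrite mem_cat => /orP[] /flatten_mapP[z sz zd].
  move: sz; rewrite inE => /orP[/eqP zy|sz].
    by apply: (@binary_adapted u v' w' y) => //; apply: unit_minor; rewrite -zy.
  have [Lz zuu] := sL z sz.
  by apply: (@complement_adapted u v' w' y z) => //; [apply: Is|apply: unit_minor].
have [Lz zuu] := sL z sz.
move: zd; rewrite !inE => /orP[] /eqP zd.
  apply: (@isotropic_adapted u v' w' z) => //; first exact: Is.
  by apply: (ounit_sqr O_val); rewrite sqr_border -zd.
apply: (@isotropic_adapted u w' v' z) => //.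
- have -> : vol u w' v' = - vol u v' w' by rewrite /vol; ring.
  by rewrite oppr_eq0.
- by apply: (integral_lattice Lz (Is z sz)).
- by apply: (ounit_sqr O_val); rewrite sqr_border -zd.
- by move=> x /sL'[Lx Ix]; split=> //; apply: (integral_lattice Lx Ix).
Qed.

(** With y(u,u) a unit, v and w can be made orthogonal to u for y, and the other
forms can be made to vanish at u by subtracting integral multiples of y. *)
Lemma pivot_adapted u v w y s :
  vol u v w != 0 -> (forall z, z \in s -> L z /\ integral z u v w) ->
  y \in s -> ounit O (bform y u u) -> adapted s.
Proof.
move=> D0 sL sy /and3P[c0 Oc Oc']; set c := bform y u u in c0 Oc Oc'.
have [Ly _] := sL y sy; have yT := L_sym Ly.
have [r rE] := K_sqrt c.
have r0 : r != 0 by apply: contraNneq c0 => r0; rewrite -rE r0 expr0n.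
pose u' := r^-1 *: u.
pose v' := v + (- (bform y u v / c)) *: u; pose w' := w + (- (bform y u w / c)) *: u.
have yuu a : bform y u (a + (- (bform y u a / c)) *: u) = 0.
  by rewrite bformDr bformZr -/c mulNr divfK ?subrr.
pose s' := [seq z - bform z u' u' *: y | z <- s].
have Or' : bform y u' u' = 1.
  by rewrite bformZl bformZr mulrA -expr2 exprVn rE mulVf.
have Ou z : z \in s -> bform z u' u' \in O.
  move=> sz; have [Lz /and5P[zuu _ _ _ _]] := sL z sz.
  by rewrite bformZl bformZr mulrA -expr2 exprVn rE rpredM.
have [|||z|p [q [t [pqt It]]]] := @normalized_adapted u' v' w' y s' _ Ly Or'.
- have -> : vol u' v' w' = r^-1 * vol u v w by rewrite /vol !mxE; ring.
  by rewrite mulf_neq0 ?invr_eq0.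
- by rewrite bformZl yuu mulr0.
- by rewrite bformZl yuu mulr0.
- move=> /mapP[x sx ->]; have [Lx _] := sL x sx; split.
    by rewrite -scaleNr addrC; apply: L_lin => //; rewrite rpredN Ou.
  by rewrite -scaleNr bformDm bformZm Or' mulr1 subrr.
exists p, q, t; split=> // z sz.
have -> : z = bform z u' u' *: y + (z - bform z u' u' *: y) by rewrite addrC subrK.
apply: integral_lin; [exact: Ou | by apply: It; rewrite mem_head | apply: It].
by rewrite inE; apply/orP; right; apply/mapP; exists z.
Qed.

(** A unit entry off the diagonal gives one on the diagonal: if y(a,b) is a unit and
y(a,a), y(b,b) are not, then y(a+b,a+b) is a unit. *)
Lemma unit_entry_adapted u v w y s :
  vol u v w != 0 -> (forall z, z \in s -> L z /\ integral z u v w) -> y \in s ->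
  [|| ounit O (bform y u u), ounit O (bform y u v), ounit O (bform y u w),
      ounit O (bform y v v), ounit O (bform y v w) | ounit O (bform y w w)] ->
  adapted s.
Proof.
move=> D0 sL sy yunit; have [Ly Iy] := sL y sy; have yT := L_sym Ly.
have pivot a b c : vol a b c != 0 -> lattice u v w a -> lattice u v w b ->
    lattice u v w c -> ounit O (bform y a a) -> adapted s.
  move=> abc la lb lc ya; apply: (@pivot_adapted a b c y s) => // z /sL[Lz Iz].
  by split=> //; apply: (integral_lattice Lz Iz).
have cross a b c : vol a b c = vol u v w \/ vol a b c = - vol u v w ->
    lattice u v w a -> lattice u v w b -> lattice u v w c ->
    ounit O (bform y a b) -> adapted s.
  move=> abc la lb lc yab.
  have abc0 : vol a b c != 0 by case: abc => ->; rewrite ?oppr_eq0.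
  have Oaa : bform y a a \in O by apply: (bform_lattice Ly Iy).
  have Obb : bform y b b \in O by apply: (bform_lattice Ly Iy).
  have Oab : bform y a b \in O by apply: (bform_lattice Ly Iy).
  have Oaa' : - bform y a a \in O by O_closed.
  have Obb' : - bform y b b \in O by O_closed.
  have [yaa|yaa] := boolP (ounit O (bform y a a)); first exact: (pivot a b c).
  have [ybb|ybb] := boolP (ounit O (bform y b b)).
    apply: (pivot b a c) => //; have -> : vol b a c = - vol a b c by rewrite /vol; ring.
    by rewrite oppr_eq0.
  apply: (pivot (a + b) b c); try lattice_closed.
    by have -> : vol (a + b) b c = vol a b c by rewrite /vol !mxE; ring.
  rewrite !bformE (bformC b a yT).
  have O2 : ounit O (2 * bform y a b).
    by apply: ounitM => //; rewrite /ounit two_neq0 O_half rpred_nat.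
  have E : 2 * bform y a b = (bform y a a + bform y a b + (bform y a b + bform y b b))
      + (- bform y a a + - bform y b b) by ring.
  rewrite E in O2; have [||//|O4] := ounitD O_val _ _ O2; try O_closed.
  by case: (ounitD O_val Oaa' Obb' O4); rewrite ounitN ?(negPf yaa) ?(negPf ybb).
have nz (a : K) : a = vol u v w \/ a = - vol u v w -> a != 0.
  by case=> ->; rewrite ?oppr_eq0.
case/or4P: yunit => [| | |/or3P[]] yunit.
- exact: (pivot u v w).
- by apply: (cross u v w) => //; left.
- by apply: (cross u w v) => //; right; rewrite /vol; ring.
- by apply: (pivot v u w) => //; apply: nz; right; rewrite /vol; ring.
- by apply: (cross v w u) => //; left; rewrite /vol; ring.
- by apply: (pivot w u v) => //; apply: nz; left; rewrite /vol; ring.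
Qed.

(** Dividing the standard basis by a square root of an entry of minimal valuation
makes all forms integral with a unit entry. *)
Theorem adapted_basis s : (forall z, z \in s -> L z) -> adapted s.
Proof.
move=> sL; pose e (i : 'I_3) : 'rV[K]_3 := delta_mx 0 i.
have vol1 : vol (e 0) (e 1) (e 2) = 1 by rewrite /vol !mxE /=; ring.
move: (e 0) (e 1) (e 2) vol1 => u v w uvw.
pose entries z := [:: bform z u u; bform z u v; bform z u w;
                      bform z v v; bform z v w; bform z w w].
pose vals := flatten [seq entries z | z <- s].
have [vals0|vals0] := eqVneq vals [::].
  exists u, v, w; split=> // z sz; suff : bform z u u \in vals by rewrite vals0.
  by apply/flatten_mapP; exists z; rewrite // !inE eqxx.
have [d vd dmin] := odvd_min O_val id vals0.
have [d0|d0] := eqVneq d 0.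
  exists u, v, w; split=> // z sz.
  have z0 a : a \in entries z -> a \in O.
    move=> za; have [|c _ /= ->] := dmin a; first by apply/flatten_mapP; exists z.
    by rewrite d0 mulr0 rpred0.
  by rewrite /integral !z0 // !inE eqxx ?orbT.
have [r rE] := K_sqrt d.
have r0 : r != 0 by apply: contraNneq d0 => r0; rewrite -rE r0 expr0n.
have scale z a b : bform z (r^-1 *: a) (r^-1 *: b) = bform z a b / d.
  by rewrite bformZl bformZr mulrA -expr2 exprVn rE mulrC.
move: vd => /flatten_mapP[y sy yd].
apply: (@unit_entry_adapted (r^-1 *: u) (r^-1 *: v) (r^-1 *: w) y) => //.
- have -> : vol (r^-1 *: u) (r^-1 *: v) (r^-1 *: w) = r^-1 ^+ 3 * vol u v w.
    by rewrite /vol !mxE; ring.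
  by rewrite uvw mulr1 expf_neq0 ?invr_eq0.
- move=> z sz; split; first exact: sL.
  have zO a : a \in entries z -> a / d \in O.
    move=> za; have [|c Oc /= ->] := dmin a; first by apply/flatten_mapP; exists z.
    by rewrite mulfK.
  by rewrite /integral !scale !zO // !inE eqxx ?orbT.
have dd : ounit O (d / d) by rewrite mulfV // ounit1.
rewrite !scale; move: yd; rewrite !inE.
by case/or4P => [| | |/or3P[]] /eqP <-; rewrite dd ?orbT.
Qed.

End IntegralBasis.

(** * The polarization of the determinant *)

Lemma adapted_matrix (K : fieldType) (O : subringClosed K) (s : seq 'M[K]_3) :
  (forall z, z \in s -> z^T = z) -> adapted O s ->
  exists2 g : 'M[K]_3, \det g = 1 &
    forall z, z \in s -> forall i j, (g *m z *m g^T) i j \in O.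
Proof.
move=> s_sym [u [v [w [uvw sO]]]]; exists (basis_mx u v w).
  by rewrite det_basis_mx.
move=> z sz i j; have zT := s_sym z sz; rewrite basis_mx_bform.
have /and5P[uu uv uw vv /andP[vw ww]] := sO z sz.
case: (i == 0); case: (i == 1); case: (j == 0); case: (j == 1) => //=;
  by rewrite (bformC _ _ zT).
Qed.

Section Polarization.
Variable A : comNzRingType.
Implicit Types (x y z : 'M[A]_3) (a b c : A).

(** The determinant of the matrix whose successive rows are taken from x, y, z. *)
Definition mixed_det x y z : A :=
  x 0 0 * (y 1 1 * z 2 2 - y 1 2 * z 2 1)
  - x 0 1 * (y 1 0 * z 2 2 - y 1 2 * z 2 0)
  + x 0 2 * (y 1 0 * z 2 1 - y 1 1 * z 2 0).

Lemma mixed_det_diag x : mixed_det x x x = \det x.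
Proof. by rewrite det3. Qed.

Lemma mixed_detl a x1 x2 y z :
  mixed_det (a *: x1 + x2) y z = a * mixed_det x1 y z + mixed_det x2 y z.
Proof. by rewrite /mixed_det !mxE; ring. Qed.

Lemma mixed_detm a x1 x2 y z :
  mixed_det y (a *: x1 + x2) z = a * mixed_det y x1 z + mixed_det y x2 z.
Proof. by rewrite /mixed_det !mxE; ring. Qed.

Lemma mixed_detr a x1 x2 y z :
  mixed_det y z (a *: x1 + x2) = a * mixed_det y z x1 + mixed_det y z x2.
Proof. by rewrite /mixed_det !mxE; ring. Qed.

(** The full polarization of det, as a sum over the permutations of (x, y, z). *)
Definition polarization x y z : A :=
  mixed_det x y z + mixed_det x z y + mixed_det y x z
  + mixed_det y z x + mixed_det z x y + mixed_det z y x.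

Lemma polarizationl a x1 x2 y z :
  polarization (a *: x1 + x2) y z = a * polarization x1 y z + polarization x2 y z.
Proof. by rewrite /polarization !(mixed_detl, mixed_detm, mixed_detr); ring. Qed.

Lemma polarization0 y z : polarization 0 y z = 0.
Proof.
by have := polarizationl (-1) 0 0 y z; rewrite scaler0 addr0 mulN1r addNr.
Qed.

Lemma polarizationC12 x y z : polarization x y z = polarization y x z.
Proof. by rewrite /polarization; ring. Qed.

Lemma polarizationC23 x y z : polarization x y z = polarization x z y.
Proof. by rewrite /polarization; ring. Qed.

Lemma polarization_diag x : polarization x x x = 6 * \det x.
Proof. by rewrite /polarization mixed_det_diag; ring. Qed.

(** Only the monomial abc matters here; every other monomial of degree 3 in a, b, c
is divisible by a square. *)
Lemma det_polarization a b c x y z : exists q1 q2 q3,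
  \det (a *: x + b *: y + c *: z) =
    a ^+ 2 * q1 + b ^+ 2 * q2 + c ^+ 2 * q3 + polarization x y z * (a * b * c).
Proof.
pose T := mixed_det; pose S x y := T x x y + T x y x + T y x x.
exists (a * T x x x + b * S x y + c * S x z),
       (a * S y x + b * T y y y + c * S y z),
       (a * S z x + b * S z y + c * T z z z).
rewrite -mixed_det_diag -addrA -[c *: z]addr0 /polarization.
rewrite !(mixed_detl, mixed_detm, mixed_detr) /S /T.
have E0 u v : mixed_det 0 u v = 0 by rewrite /mixed_det !mxE; ring.
have E1 u v : mixed_det u 0 v = 0 by rewrite /mixed_det !mxE; ring.
have E2 u v : mixed_det u v 0 = 0 by rewrite /mixed_det !mxE; ring.
by rewrite !(E0, E1, E2); ring.
Qed.

(** The polarization is trilinear and equals 6 det z on (z, z, z), so its values on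
the generators control det on their O-span. *)
Lemma polarization_span (O : subringClosed A) p (Z : 'I_p -> 'M[A]_3) :
  (forall i j k, polarization (Z i) (Z j) (Z k) \in O) ->
  forall c : 'I_p -> A, (forall i, c i \in O) ->
  6 * \det (\sum_i c i *: Z i) \in O.
Proof.
move=> ZO c cO; set z := \sum_i _; rewrite -polarization_diag.
have span x y : (forall i, polarization (Z i) x y \in O) -> polarization z x y \in O.
  move=> xyO; rewrite /z; elim/big_rec: _ => [|i t _ tO].
    by rewrite polarization0 rpred0.
  by rewrite polarizationl rpredD ?rpredM.
apply: (span) => i; rewrite polarizationC12; apply: (span) => j.
rewrite polarizationC23 polarizationC12; apply: (span) => k; exact: ZO.
Qed.

End Polarization.

Lemma mixed_det_map (A A' : comNzRingType) (f : {rmorphism A -> A'}) x y z :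
  mixed_det (map_mx f x) (map_mx f y) (map_mx f z) = f (mixed_det x y z).
Proof. by rewrite /mixed_det !mxE rmorphD rmorphB !rmorphM !rmorphB !rmorphM. Qed.

Lemma polarization_map (A A' : comNzRingType) (f : {rmorphism A -> A'}) x y z :
  polarization (map_mx f x) (map_mx f y) (map_mx f z) = f (polarization x y z).
Proof.
by rewrite /polarization !mixed_det_map !rmorphD.
Qed.

Lemma mcoeff_sqrXM (n : nat) (A : comNzRingType) (i : 'I_n) (q : {mpoly A[n]})
    (m : 'X_{1..n}) :
  (m i < 2)%N -> ('X_i ^+ 2 * q)@_m = 0.
Proof.
move=> m2; rewrite [q]mpolyE mulr_sumr raddf_sum big1 // => k _ /=.
rewrite -scalerAr mcoeffZ expr2 -!mpolyXD mcoeffX.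
case: eqP => [E|]; last by rewrite mulr0.
by move: m2; rewrite -E !mnmDE mnm1E eqxx.
Qed.

Lemma polar_detE (R : realType) (x y z : symmat R) :
  polar_det x y z = polarization (val x) (val y) (val z).
Proof.
have [q1 [q2 [q3 E]]] := det_polarization 'X_(0 : 'I_3) 'X_(1 : 'I_3) 'X_(2 : 'I_3)
  (map_mx (@mpolyC 3 R[i]) (val x)) (map_mx (@mpolyC 3 R[i]) (val y))
  (map_mx (@mpolyC 3 R[i]) (val z)).
rewrite /polar_det E !mcoeffD !mcoeff_sqrXM ?mnmE // !add0r polarization_map.
rewrite mcoeffCM -!mpolyXD mcoeffX.
suff -> : (U_(0%R) + U_(1%R) + U_(2%R) == [multinom 1%N | _ < 3])%MM by rewrite mulr1.
apply/eqP/mnmP => i; rewrite !mnmDE !mnm1E mnmE.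
by case: i => [[|[|[|]]]] //.
Qed.

(** * Invariant polynomial functions *)

Lemma subalg_closed_smallest (K : nzRingType) (A : lalgType K) (G : set A) :
  GRing.subalg_closed (mem (generated_subalgebra G)).
Proof.
split=> [|a x y /set_mem Gx /set_mem Gy|x y /set_mem Gx /set_mem Gy];
  apply/mem_set => S [/= Sc GS]; have [S1 SZ SM] := Sc; apply/set_mem => //.
- by apply: SZ; apply/mem_set; [apply: Gx|apply: Gy].
- by apply: SM; apply/mem_set; [apply: Gx|apply: Gy].
Qed.

(** Any lift H of g to a matrix of functions has det H - 1 in the kernel of pi.
Replacing H by the identity where its determinant is not 1 changes its entries by
multiples of det H - 1, because functions have pointwise pseudo-inverses. *)
Lemma lift_special_linear (k : fieldType) (T : pointedType) (K : fieldType)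
    (pi : {rmorphism (T -> k) -> K}) (g : 'M[K]_3) :
  (forall y, exists x, pi x = y) -> \det g = 1 ->
  exists2 G : T -> 'M[k]_3, forall t, \det (G t) = 1 &
    forall i j, pi (fun t => G t i j) = g i j.
Proof.
move=> pi_surj g1.
have /choice[h hP] (ij : 'I_3 * 'I_3) : exists x, pi x = g ij.1 ij.2 by [].
pose H : 'M[T -> k]_3 := \matrix_(i, j) h (i, j).
pose Ht t : 'M[k]_3 := \matrix_(i, j) h (i, j) t.
pose G t := if \det (Ht t) == 1 then Ht t else 1%:M.
exists G => [t|i j]; first by rewrite /G; case: eqP => //; rewrite det1.
have piH : pi (\det H - 1) = 0.
  have mapH : map_mx pi H = g by apply/matrixP => a b; rewrite !mxE hP.
  by rewrite rmorphB rmorph1 -det_map_mx mapH g1 subrr.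
have detH t : (\det H - 1) t = \det (Ht t) - 1.
  by rewrite [\det (Ht t)]det3 det3 !mxE.
apply/eqP; rewrite -subr_eq0 -(hP (i, j)) -rmorphB; apply/eqP.
set d : T -> k := _ - _.
have -> : d = d * (fun t => ((\det H - 1) t)^-1) * (\det H - 1).
  apply/funext => t.
  suff E0 : d t = d t * ((\det H - 1) t)^-1 * (\det H - 1) t by [].
  have [E|E] := eqVneq ((\det H - 1) t) 0; last by rewrite divfK.
  rewrite E mulr0 /d.
  suff E1 : G t i j - h (i, j) t = 0 by [].
  by rewrite /G -subr_eq0 -detH E eqxx mxE subrr.
by rewrite rmorphM piH mulr0.
Qed.

Section IntegralityOfInvariants.
Variables (R : realType) (p : nat).
Local Notation C := R[i].
Local Notation A := (copies R p -> C).

Definition generic_matrix (i : 'I_p) : 'M[A]_3 :=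
  \matrix_(a, b) ((fun x : copies R p => val (x i) a b) : A).

Lemma polarization_generic i j k :
  polarization (generic_matrix i) (generic_matrix j) (generic_matrix k) =
  (fun x => polar_det (x i) (x j) (x k)) :> A.
Proof.
by apply/funext => x; rewrite polar_detE /polarization /mixed_det !mxE.
Qed.

(** A polynomial function along y is a polynomial with constant coefficients in the
entries of y, so it lies in any subring containing both. *)
Lemma polynomial_function_closed (O : subringClosed A) (F : A)
    (y : copies R p -> copies R p) :
  polynomial_function F -> (forall c : C, (fun=> c) \in O) ->
  (forall i a b, (fun x => val (y x i) a b) \in O) ->
  (fun x => F (y x)) \in O.
Proof.
move=> [P FP] OC Oy.
have -> : (fun x => F (y x)) = \sum_(m <- msupp P) (fun=> P@_m) *
    \prod_k (fun x => coordinates (y x) k) ^+ m k :> A.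
  apply/funext => x; rewrite FP mevalE fct_sumE; apply: eq_bigr => m _.
  rewrite [RHS]/(_ * _); congr (_ * _); rewrite fct_prodE; apply: eq_bigr => k _.
  by elim: (m k) => // n IHn; rewrite !exprS IHn.
apply: rpred_sum => m _; apply: rpredM => //; apply: rpred_prod => k _.
apply: rpredX; rewrite /coordinates; case: (enum_val k) => [[i a] b]; exact: Oy.
Qed.

End IntegralityOfInvariants.

Unset Implicit Arguments.

Theorem mainTheorem3 (R : realType) (p : nat) (hp : (1 <= p)%N) :
  forall F : copies R p -> R[i],
    invariant_algebra R p F -> integral_over (polar_det_algebra R p) F.
Proof.
move=> F [Fpoly Finv]; set A := copies R p -> R[i].
have [B1 BZ BM] := subalg_closed_smallest
  [set F : A | exists i j k, F = fun x => polar_det (x i) (x j) (x k)].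
have [|x y Bx By|x y Bx By|B BP] := @subringClosed_of A (polar_det_algebra R p).
- exact: set_mem.
- apply: set_mem; rewrite -[x - y]addrC -scaleN1r; apply: BZ; exact: mem_set.
- by apply: set_mem; apply: BM; exact: mem_set.
apply: (integral_overW (S := [set` B])); first by move=> x /BP.
have BC (c : R[i]) : (fun=> c) \in B.
  apply/BP/set_mem.
  have -> : (fun=> c) = c *: 1 + 0 :> A.
    by rewrite addr0; apply/funext => x; suff : c = c * 1 by []; rewrite mulr1.
  apply: (BZ) => //; rewrite -(subrr 1) addrC -scaleN1r; exact: BZ.
(* The pointwise inverse, 0 where u vanishes, shows that A is von Neumann regular. *)
apply: valuative_criterion => [u|K pi O pi_surj O_val BO].
  exists (fun x => (u x)^-1); apply/funext => x.
  suff : u x * (1 - u x * (u x)^-1) = 0 by [].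
  have [->|u0] := eqVneq (u x) 0; first by rewrite mul0r.
  by rewrite mulfV // subrr mulr0.
have OC c : pi (fun=> c) \in O by apply/BO/BC.
have nat_inv n : n.+1%:R * pi (fun=> n.+1%:R^-1) = 1.
  rewrite -[n.+1%:R](rmorph_nat pi) -rmorphM -(rmorph1 pi); congr (pi _).
  have -> : n.+1%:R = (fun=> n.+1%:R) :> A.
    elim: n.+1 => // m IHm; rewrite mulrS IHm; apply/funext => x.
    by suff : 1 + m%:R = m.+1%:R :> R[i] by []; rewrite mulrS.
  apply/funext => x; suff : n.+1%:R * n.+1%:R^-1 = 1 :> R[i] by [].
  by rewrite mulfV ?Num.Theory.pnatr_eq0.
have nat_neq0 n : n.+1%:R != 0 :> K.
  by apply: contraTneq (oner_neq0 K) => n0; rewrite -(nat_inv n) n0 mul0r eqxx.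
have nat_invE n : n.+1%:R^-1 \in O.
  have -> : n.+1%:R^-1 = pi (fun=> n.+1%:R^-1); last exact: OC.
  by apply: (mulfI (nat_neq0 n)); rewrite nat_inv mulfV.
have /choice[sq sqK] (c : R[i]) : exists r : R[i], r ^+ 2 = c.
  by eexists; exact: Num.Theory.sqrtCK.
have K_sqrt (a : K) : exists r : K, r ^+ 2 = a.
  have [u <-] := pi_surj a; exists (pi (fun x => sq (u x))).
  rewrite -rmorphXn; congr (pi _); apply/funext => x; exact: sqK.
pose Z i := map_mx pi (generic_matrix R i : 'M[A]_3).
have Zpol i j k : polarization (Z i) (Z j) (Z k) \in O.
  rewrite polarization_map polarization_generic; apply/BO/BP.
  by apply: sub_gen_smallest; exists i, j, k.
pose L z := exists2 c : 'I_p -> K, forall i, c i \in O & z = \sum_i c i *: Z i.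
have Z_sym i : (Z i)^T = Z i.
  apply/matrixP => a b; rewrite !mxE; congr (pi _); apply/funext => x.
  by have /eqP/matrixP/(_ a b) := valP (x i); rewrite mxE.
have Z_adapted : adapted O (codom Z).
  apply: (@adapted_basis K O O_val (nat_neq0 1) (nat_invE 1) K_sqrt L).
  - move=> a _ _ Oa [c Oc ->] [d Od ->]; exists (fun i => a * c i + d i).
      by move=> i; rewrite rpredD ?rpredM.
    rewrite scaler_sumr -big_split; apply: eq_bigr => i _.
    by rewrite /= scalerDl scalerA.
  - move=> _ [c _ ->]; rewrite linear_sum; apply: eq_bigr => i _.
    by rewrite linearZ /= Z_sym.
  - move=> _ [c Oc ->]; rewrite -[\det _](mulKf (nat_neq0 5)).
    by rewrite rpredM // polarization_span.
  - move=> _ /codomP[i ->]; exists (fun j => (j == i)%:R) => [j|].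
      by rewrite rpred_nat.
    rewrite (bigD1 i) //= eqxx scale1r big1 ?addr0 // => j /negPf->.
    by rewrite scale0r.
have [|g g1 gZ] := adapted_matrix _ Z_adapted; first by move=> _ /codomP[i ->].
have [G G1 piG] := lift_special_linear pi_surj g1.
(* The group element G x depends on the point x: invariance is used pointwise. *)
have -> : F = (fun x => F (fun i => act (G x) (x i))).
  by apply/funext => x; rewrite Finv.
have [|||O' O'P] := @subringClosed_of A (fun u => pi u \in O).
- by rewrite rmorph1 rpred1.
- by move=> u v Ou Ov; rewrite rmorphB rpredB.
- by move=> u v Ou Ov; rewrite rmorphM rpredM.
apply/O'P/(polynomial_function_closed (y := fun x i => act (G x) (x i))) => // [c|i a b].
  exact/O'P.
apply/O'P; pose H : 'M[A]_3 := \matrix_(a, b) (fun x => G x a b).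
have mapH : map_mx pi H = g by apply/matrixP => c d; rewrite !mxE piG.
have -> : (fun x => val (act (G x) (x i)) a b) = (H *m generic_matrix R i *m H^T) a b.
  apply/funext => x; rewrite !mxE !sum3 !mxE !sum3 !mxE.
  by [].
have -> : pi ((H *m generic_matrix R i *m H^T) a b) = (g *m Z i *m g^T) a b.
  by rewrite -mapH matrix.map_trmx -!map_mxM [RHS]mxE.
by apply: gZ; apply: codom_f.
Qed.
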